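(* Let $m\geq 5$ be an integer with $m\neq 9$. Then the largest $d$ for which there exists a non-Denniston maximal arc of degree $2^d$ in $\mathrm{PG}(2,2^m)$ generated by a $\{p,1\}$-map is $\lfloor\frac{m}{2}\rfloor+1$.
   Context: $\mathrm{Tr}$ denotes the trace from $\mathbb{F}_{2^m}$ to $\mathbb{F}_2$. $\mathrm{PG}(2,2^m)$ is the desarguesian projective plane over $\mathbb{F}_{2^m}$ with homogeneous coordinates $(x,y,z)$. A maximal arc of degree $n$ in $\mathrm{PG}(2,2^m)$ is a set $\mathcal{K}$ of $2^m(n-1)+n$ points such that no $n+1$ points of $\mathcal{K}$ are collinear. For $\alpha,\beta,\lambda\in\mathbb{F}_{2^m}^*$ with $\mathrm{Tr}(\alpha\beta)=1$ (equivalently $\alpha x^2+x+\beta$ irreducible over $\mathbb{F}_{2^m}$) let $F_{\alpha,\beta,\lambda}=\{(x,y,z)\in\mathrm{PG}(2,2^m)\mid \alpha x^2+xy+\beta y^2+\lambda z^2=0\}$, a non-degenerate conic with nucleus $(0,0,1)$, and let $F_0=\{(0,0,1)\}$. Maximal arcs generated by $\{p,q\}$-maps: let $p(x)=\sum_{i=0}^{d-1}a_ix^{2^i-1}$ and $q(x)=\sum_{i=0}^{d-1}b_ix^{2^i-1}$ be in $\mathbb{F}_{2^m}[x]$, and let $A$ be an additive subgroup of order $2^d$ of $\mathbb{F}_{2^m}$ such that $\mathrm{Tr}(p(\lambda)q(\lambda))=1$ for every $\lambda\in A\setminus\{0\}$. Then (known theorem of Mathon) the set $\mathcal{K}=F_0\cup\bigcup_{\lambda\in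 A\setminus\{0\}}F_{p(\lambda),q(\lambda),\lambda}$ is a maximal arc of degree $2^d$ in $\mathrm{PG}(2,2^m)$, called the maximal arc generated by the $\{p,q\}$-map. A $\{p,1\}$-map is the case where $q$ is the constant polynomial $1$. Denniston maximal arcs: let $Q(x,y)=ax^2+hxy+by^2$ be an irreducible quadratic form over $\mathbb{F}_{2^m}$ (i.e. $h\ne0$ and $\mathrm{Tr}(ab/h^2)=1$) and let $A$ be an additive subgroup of $\mathbb{F}_{2^m}$; then $\{(x,y,1)\in\mathrm{PG}(2,2^m)\mid Q(x,y)\in A\}$ is a maximal arc of degree $|A|$. These arcs, and those projectively equivalent to them, are called Denniston maximal arcs; a maximal arc is non-Denniston if it is not of this kind. *)

(* Defs.v *)
From HB Require Import structures.
From mathcomp Require Import all_boot all_order all_algebra.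

Set Implicit Arguments.
Unset Strict Implicit.
Unset Printing Implicit Defensive.

Import GRing.Theory.
Local Open Scope ring_scope.

(* The absolute trace  x + x^2 + ... + x^(2^(m-1))  onto the prime field,
   where #|F| = 2 ^ m; its values are 0 and 1, seen in F. *)
Definition Tr (F : finFieldType) (x : F) : F :=
  \sum_(i < logn 2 #|F|) x ^+ (2 ^ i).

(* A point of PG(2, q) is a one-dimensional subspace of F^3, represented by
   the set of its vectors (the zero vector included). *)
Definition pt (F : finFieldType) (v : 'rV[F]_3) : {set 'rV[F]_3} :=
  [set a *: v | a : F].

Definition PG2 (F : finFieldType) : {set {set 'rV[F]_3}} :=
  [set pt v | v : 'rV[F]_3 & v != 0].

Definition vec3 (F : finFieldType) (x y z : F) : 'rV[F]_3 :=
  \row_(i < 3) [:: x; y; z]`_i.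

Definition collinear (F : finFieldType) (S : {set {set 'rV[F]_3}}) : Prop :=
  exists U : {vspace 'rV[F]_3},
    \dim U = 2%N /\ forall P, P \in S -> {subset P <= U}.

Definition maximal_arc (F : finFieldType) (n : nat)
    (K : {set {set 'rV[F]_3}}) : Prop :=
  [/\ K \subset PG2 F,
      #|K| = (#|F| * (n - 1) + n)%N
    & forall S : {set {set 'rV[F]_3}},
        S \subset K -> #|S| = n.+1 -> ~ collinear S].

Definition conic (F : finFieldType) (alpha beta lambda : F) :
    {set {set 'rV[F]_3}} :=
  [set pt v | v : 'rV[F]_3 &
     (v != 0) &&
     (let x := v 0 0 in let y := v 0 1 in let z := v 0 2 in
      alpha * x ^+ 2 + x * y + beta * y ^+ 2 + lambda * z ^+ 2 == 0)].

Definition mathon_poly (F : finFieldType) (d : nat) (p : {poly F}) : Prop :=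
  exists a : 'I_d -> F, p = \sum_(i < d) a i *: 'X^(2 ^ i - 1).

Definition is_pq_map (F : finFieldType) (d : nat) (p q : {poly F})
    (A : {set F}) : Prop :=
  [/\ mathon_poly d p,
      mathon_poly d q,
      zmod_closed A,
      #|A| = (2 ^ d)%N
    & forall lambda, lambda \in A -> lambda != 0 ->
        Tr (p.[lambda] * q.[lambda]) = 1].

Definition pq_arc (F : finFieldType) (p q : {poly F}) (A : {set F}) :
    {set {set 'rV[F]_3}} :=
  pt (vec3 0 0 1)
    |: \bigcup_(lambda in A :\ 0) conic p.[lambda] q.[lambda] lambda.

Definition generated_by_p1_map (F : finFieldType) (d : nat)
    (K : {set {set 'rV[F]_3}}) : Prop :=
  exists (p : {poly F}) (A : {set F}), is_pq_map d p 1 A /\ K = pq_arc p 1 A.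

Definition denniston_set (F : finFieldType) (a h b : F) (A : {set F}) :
    {set {set 'rV[F]_3}} :=
  [set pt (vec3 x y 1) | x in F, y in F &
     a * x ^+ 2 + h * x * y + b * y ^+ 2 \in A].

Definition projective_image (F : finFieldType) (g : 'M[F]_3)
    (K : {set {set 'rV[F]_3}}) : {set {set 'rV[F]_3}} :=
  [set [set v *m g | v in P] | P : {set 'rV[F]_3} in K].

(* In even characteristic, the form  a x^2 + h x y + b y^2  is irreducible
   exactly when h != 0 and Tr (a b / h^2) = 1.  Projective equivalence is
   taken under PGL(3, q); field automorphisms send [denniston_set]s to
   [denniston_set]s, so PGammaL(3, q) would yield the same class. *)
Definition denniston (F : finFieldType) (K : {set {set 'rV[F]_3}}) : Prop :=
  exists (a h b : F) (A : {set F}) (g : 'M[F]_3),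
    [/\ h != 0,
        Tr (a * b / h ^+ 2) = 1,
        zmod_closed A,
        g \in unitmx
      & K = projective_image g (denniston_set a h b A)].

Definition nonDenniston_p1_degree (F : finFieldType) (d : nat) : Prop :=
  exists K : {set {set 'rV[F]_3}},
    [/\ maximal_arc (2 ^ d) K, generated_by_p1_map d K & ~ denniston K].

(* Main.v *)
From HB Require Import structures.
Require Import Defs.
From mathcomp Require Import all_boot all_order all_algebra.
From mathcomp Require Import all_fingroup all_field ring zify.

Set Implicit Arguments.
Unset Strict Implicit.
Unset Printing Implicit Defensive.

Import GRing.Theory.

(** Write q = 2^m and let p be a polynomial with exponents 2^i - 1, so that x p(x)
    is additive.  Three facts give the theorem.

    For d <= m - 2 the arc is Denniston exactly when p is affine on A.  If
    p = a0 + a1 x on A, the elation z -> z + sqrt(a1) x carries the conics of the arc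
    into one pencil ([affine_map_denniston]).  Conversely, in a Denniston arc each conic
    F_(p(la), 1, la) has q + 1 points on fewer than 2^d conics of a pencil, hence
    at least five on one of them, and five common points make the two
    conics equal; so all conics of the arc lie in one pencil and p is affine
    ([denniston_pencil]).

    Degree floor(m/2) + 1 is reached by p = a0 + a1 x + x^3 with Tr a0 = 1.  Here
    Tr p = 1 on A means that Tr(x^3) agrees with an additive functional on A, i.e.
    that A is totally isotropic for the alternating form Tr(u^2 v + u v^2).  The
    radical of that form is the intersection of F with F_4, so there is such an A
    of dimension floor(m/2) + 1 ([cubic_isotropic]).

    No larger degree is possible ([trace_one_poly_affine]).  Let 2d >= m + 3, and
    let Tr p = 1 on A, where p has leading exponent 2^r - 1 with r >= 2.
    Summing Tr p over the combinations of u_1, ..., u_r in A kills all lower terms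
    and leaves Tr(a M(u_1, ..., u_r)) = 0, where M is the Moore determinant
    det(u_i^(2^j)) ([top_moore_trace]).  With a basis b of A and the columns
    X_j = (b_i^(2^j)), periodic in j modulo m, expanding the trace and extending
    scalars gives
      sum over w < m of a^(2^w) det[V | X_w, ..., X_(w+r-1)] = 0
    for every matrix V over F ([laplace_moore]).  If the columns of V are chosen among
    the X_j so that they meet all cyclic windows of length r but one, a single
    determinant survives, so certain d of the X_j are dependent.  As any d consecutive
    X_j are independent, such dependencies are contradictory as soon as
    2r >= d and r <= d - 2 ([isotropic_for_moore_absurd]); the one exception is
    m = 9, d = 6, r = 3.  For 2r < d one passes to the space E spanned by the dual
    basis of b: complementary minors ([dual_minor]) turn the condition of degree r on A
    into the one of degree d - r on E ([moore_form_not_isotropic]).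

    The cases r = d - 1 and r = d - 2 are settled together ([top_two_vanish]).  On A the
    monomial x^(2^(d-1)) is a combination of sqrt(x), x, ..., x^(2^(d-2)), which turns
    the leading term of Tr p into Tr(e / x).  The moments of 1 / x against two
    functionals on A are sqrt(y z) with y, z in E ([pairing_inv_sum]), and one finds
    that E is totally isotropic for Tr(G y z + H (y^2 z + y z^2)).  Unless
    G = H = 0 this form has radical of dimension at most 2, which forces
    2d <= m + 2 ([isotropic_bound]). *)

Local Open Scope ring_scope.

(** * Frobenius powers and the trace *)

(** The proof that the characteristic is 2 is an argument so that the map can carry
    its ring morphism structure. *)
Definition frobenius (F : finFieldType) (c2 : 2%N \in [pchar F]) (j : nat) (x : F) : F :=
  x ^+ (2 ^ j).

Lemma frobenius_additive (F : finFieldType) (c2 : 2%N \in [pchar F]) j :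
  zmod_morphism (frobenius c2 j).
Proof.
move=> x y; rewrite !(oppr_pchar2 c2) /frobenius; apply: exprDn_pchar.
by rewrite pnatX (pnatE _ (isT : prime 2)) c2.
Qed.

Lemma frobenius_multiplicative (F : finFieldType) (c2 : 2%N \in [pchar F]) j :
  monoid_morphism (frobenius c2 j).
Proof. by split=> [|x y]; rewrite /frobenius ?expr1n ?exprMn. Qed.

HB.instance Definition _ (F : finFieldType) (c2 : 2%N \in [pchar F]) j :=
  GRing.isZmodMorphism.Build F F (frobenius c2 j) (frobenius_additive c2 j).
HB.instance Definition _ (F : finFieldType) (c2 : 2%N \in [pchar F]) j :=
  GRing.isMonoidMorphism.Build F F (frobenius c2 j) (frobenius_multiplicative c2 j).

Section CharTwo.
Variables (F : finFieldType) (m : nat).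
Hypothesis hF : #|F| = (2 ^ m)%N.

Lemma pchar2 : 2%N \in [pchar F].
Proof. exact: card_finPcharP hF _. Qed.

Lemma addxx (x : F) : x + x = 0.
Proof. exact: addrr_pchar2 pchar2 x. Qed.

Lemma two0 : 2 = 0 :> F.
Proof. by rewrite -[2]/(1 + 1) addxx. Qed.

Lemma oppx (x : F) : - x = x.
Proof. exact: oppr_pchar2 pchar2 x. Qed.

Lemma addr_eq0_2 (x y : F) : (x + y == 0) = (x == y).
Proof. by rewrite addr_eq0 oppx. Qed.



Local Notation frob := (frobenius pchar2).

Lemma frob0 x : frob 0 x = x. Proof. by []. Qed.

Lemma frob_frob i j x : frob i (frob j x) = frob (i + j) x.
Proof. by rewrite /frobenius -exprM -expnD addnC. Qed.

Lemma frob_m x : frob m x = x.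
Proof. by rewrite /frobenius -hF expf_card. Qed.

Lemma frob_modm j x : frob (j %% m) x = frob j x.
Proof.
rewrite [in RHS](divn_eq j m).
elim: (j %/ m)%N => [|n IH]; first by rewrite mul0n add0n.
by rewrite mulSn -addnA addnC -frob_frob frob_m.
Qed.

Lemma frob_eqm i j x : i = j %[mod m] -> frob i x = frob j x.
Proof. by move=> e; rewrite -frob_modm e frob_modm. Qed.

Lemma frobS j x : frob j.+1 x = frob j x ^+ 2.
Proof. by rewrite -[X in X ^+ 2]/(frob j x) -[_ ^+ 2]/(frob 1 _) frob_frob. Qed.

Lemma frobSl j x : frob j.+1 x = frob j (x ^+ 2).
Proof. by rewrite -[x ^+ 2]/(frob 1 x) frob_frob addn1. Qed.

Lemma frob_bool j (b : bool) : frob j b%:R = b%:R.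
Proof. by rewrite rmorph_nat. Qed.

Lemma TrE (x : F) : Tr x = \sum_(i < m) frob i x.
Proof. by rewrite /Tr hF (pfactorK _ (isT : prime 2)). Qed.

Lemma TrD (x y : F) : Tr (x + y) = Tr x + Tr y.
Proof. by rewrite !TrE -big_split; apply: eq_bigr => i _; rewrite rmorphD. Qed.

Lemma Tr0 : Tr (0 : F) = 0.
Proof. by rewrite TrE big1 // => i _; rewrite rmorph0. Qed.

Lemma Tr_sum (I : Type) (s : seq I) (P : pred I) (G : I -> F) :
  Tr (\sum_(i <- s | P i) G i) = \sum_(i <- s | P i) Tr (G i).
Proof. exact: (big_morph _ TrD Tr0). Qed.

Lemma m_gt0 : (0 < m)%N.
Proof. by case: m hF (finNzRing_gt1 F) => // ->. Qed.

Lemma Tr_frob j (x : F) : Tr (frob j x) = Tr x.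
Proof.
elim: j => // j IH; rewrite -IH {IH} frobS; move: (frob j x) => {j x} x.
rewrite !TrE; case: m m_gt0 (frob_m) => // n _ fm.
rewrite big_ord_recr big_ord_recl /= -frobSl fm frob0 addrC; congr (_ + _).
by apply: eq_bigr => i _; rewrite -frobSl.
Qed.

Lemma Tr_sqr (x : F) : Tr (x ^+ 2) = Tr x.
Proof. exact: (Tr_frob 1). Qed.

Lemma frob_Tr j (x : F) : frob j (Tr x) = Tr x.
Proof.
apply: etrans (Tr_frob j x); rewrite !TrE rmorph_sum; apply: eq_bigr => i _.
by rewrite /= !frob_frob addnC.
Qed.

Lemma Tr01 (x : F) : (Tr x == 0) || (Tr x == 1).
Proof.
have := frob_Tr 1 x; rewrite /frobenius expr2 => h.
by rewrite -[_ == 1]subr_eq0 -mulf_eq0 mulrBr mulr1 h subrr.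
Qed.

Lemma Tr_neq0 (x : F) : (Tr x != 0) = (Tr x == 1).
Proof. by case/orP: (Tr01 x) => /eqP ->; rewrite ?eqxx ?oner_eq0 // eq_sym oner_eq0. Qed.

(** The trace is a polynomial function of degree 2^(m-1), hence vanishes on at
    most half of the field. *)
Lemma Tr_onto : exists x : F, Tr x = 1.
Proof.
pose T : {poly F} := \sum_(i < m) 'X^(2 ^ i).
have sT : (size T <= (2 ^ m.-1).+1)%N.
  apply: (leq_trans (size_sum _ _ _)); apply/bigmax_leqP => i _.
  by rewrite size_polyXn ltnS leq_exp2l // -ltnS prednK ?m_gt0.
have nT : T != 0.
  apply/eqP => /(congr1 (fun p : {poly F} => p`_1)) /eqP.
  rewrite coef_sum coef0 (bigD1 (Ordinal m_gt0)) //= coefXn eqxx big1 ?addr0 ?oner_eq0 //.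
  move=> i ni; rewrite coefXn; case: eqP => // /esym /eqP.
  by rewrite -[1%N]/(2 ^ 0)%N eqn_exp2l // => e; rewrite -val_eqE /= e in ni.
have /existsP [x hx] : [exists x : F, Tr x != 0].
  apply: contraT; rewrite negb_exists => /forallP h.
  have := max_poly_roots (p := T) (rs := enum F) nT; rewrite enum_uniq => /(_ _ isT).
  have -> : all (root T) (enum F).
    apply/allP => x _; have := h x; rewrite negbK TrE rootE horner_sum => /eqP e.
    by apply/eqP; rewrite -[RHS]e; apply: eq_bigr => i _; rewrite hornerXn.
  move=> /(_ isT) h1; have := leq_trans h1 sT.
  rewrite -cardE hF ltnS leq_exp2l //; have := m_gt0; lia.
by exists x; apply/eqP; rewrite -Tr_neq0.
Qed.

Lemma Tr_nondeg (c : F) : c != 0 -> exists x, Tr (c * x) = 1.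
Proof.
by move=> nc; have [x hx] := Tr_onto; exists (x / c); rewrite mulrC divfK.
Qed.

End CharTwo.

(** * Sums over the cube of coordinates *)

Section Cube.
Variables (F : finFieldType) (m : nat).
Hypothesis hF : #|F| = (2 ^ m)%N.

(** The sum factors over the coordinates; a coordinate that g misses contributes
    the factor 1 + 1 = 0. *)
Lemma cube_sum_hits n d (g : 'I_n -> 'I_d) :
  \sum_(c : {ffun 'I_d -> bool}) \prod_t (c (g t))%:R
  = [forall i, exists t, g t == i]%:R :> F.
Proof.
transitivity (\sum_(c : {ffun 'I_d -> bool})
                 \prod_i \prod_(t | g t == i) ((c i)%:R : F)).
  apply: eq_bigr => c _; rewrite (partition_big g predT) //=.
  by apply: eq_bigr => i _; apply: eq_bigr => t /eqP ->.
rewrite -(bigA_distr_bigA (fun i (b : bool) => \prod_(t | g t == i) b%:R)) /=.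
transitivity (\prod_(i < d) [exists t, g t == i]%:R : F).
  apply: eq_bigr => i _; rewrite big_bool /= [X in X + _]big1 //.
  case: existsP => [[t /eqP ht]|h].
    by rewrite (bigD1 t) ?ht ?eqxx //= mul0r addr0.
  rewrite big_pred0 ?(addxx hF) // => t; apply/negP => /eqP ht; apply: h.
  by exists t; rewrite ht.
case: forallP => [h|/forallP]; first by apply: big1 => i _; rewrite h.
rewrite negb_forall => /existsP [i hi].
by rewrite (bigD1 i) //= (negbTE hi) mul0r.
Qed.

Lemma cube_sum_expand n d (V : 'I_n -> 'I_d -> F) :
  \sum_(c : {ffun 'I_d -> bool}) \prod_t \sum_i (c i)%:R * V t i
  = \sum_(g : {ffun 'I_n -> 'I_d})
       [forall i, exists t, g t == i]%:R * \prod_t V t (g t).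
Proof.
transitivity (\sum_(c : {ffun 'I_d -> bool}) \sum_(g : {ffun 'I_n -> 'I_d})
    \prod_t ((c (g t))%:R * V t (g t))).
  by apply: eq_bigr => c _; rewrite (bigA_distr_bigA (fun t i => (c i)%:R * V t i)).
rewrite exchange_big; apply: eq_bigr => g _ /=.
rewrite -(cube_sum_hits g) mulr_suml; apply: eq_bigr => c _.
by rewrite big_split.
Qed.

(** A product of fewer than d linear forms is a Boolean function of degree below d,
    so it sums to 0 over the cube. *)
Lemma cube_sum_small n d (V : 'I_n -> 'I_d -> F) : (n < d)%N ->
  \sum_(c : {ffun 'I_d -> bool}) \prod_t \sum_i (c i)%:R * V t i = 0.
Proof.
move=> nd; rewrite cube_sum_expand big1 // => g _.
case: forallP => [h|]; last by rewrite mul0r.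
suff: (d <= n)%N by rewrite leqNgt nd.
rewrite -[d]card_ord -[n]card_ord.
have -> : #|'I_d| = #|codom g|.
  by apply: eq_card => i; symmetry; case/existsP: (h i) => t /eqP <-; rewrite codom_f.
exact: leq_image_card.
Qed.

(** Only the bijections g survive, which leaves the permanent; it is the determinant
    in characteristic 2. *)
Lemma cube_sum_det d (V : 'I_d -> 'I_d -> F) :
  \sum_(c : {ffun 'I_d -> bool}) \prod_t \sum_i (c i)%:R * V t i
  = \det (\matrix_(i, t) V t i).
Proof.
rewrite cube_sum_expand (bigID (fun g : {ffun 'I_d -> 'I_d} => injectiveb g)) /=.
rewrite addrC big1 ?add0r => [|g Ug]; last first.
  case: forallP => [h|]; last by rewrite mul0r.
  have gi : {in 'I_d &, injective g}.
    apply/image_injP/eqP; apply: eq_card => i.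
    by case/existsP: (h i) => t /eqP <-; apply: codom_f.
  by case/injectiveP: Ug => x y; apply: gi.
rewrite (reindex (@pval _)) /=; last first.
  pose in_Sn := insubd (1%g : 'S_d).
  by exists in_Sn => /= f Uf; first apply: val_inj; apply: insubdK.
rewrite -det_tr; apply: eq_big => /= [s|s _]; first by rewrite (valP s).
rewrite (_ : [forall i, _]); last first.
  apply/forallP => i; apply/existsP; exists (perm_inv s i).
  by rewrite pvalE permKV.
rewrite mul1r; have -> : (-1) ^+ s = 1 :> F by rewrite (oppx hF) expr1n.
by rewrite mul1r; apply: eq_bigr => t _; rewrite !mxE pvalE.
Qed.

End Cube.

(** * Moore determinants and cyclic windows *)

Section Moore.
Variables (F : finFieldType) (m : nat).
Hypothesis hF : #|F| = (2 ^ m)%N.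
Local Notation frob := (frobenius (pchar2 hF)).

Definition moore n r (u : 'I_n -> F) (w : nat) : 'M[F]_(n, r) :=
  \matrix_(i, c) frob (w + c) (u i).

Lemma moore_frob n r (u : 'I_n -> F) w v :
  moore r u (w + v) = map_mx (frob w) (moore r u v).
Proof. by apply/matrixP => i c; rewrite !mxE frob_frob addnA. Qed.

Lemma det_moore_frob r (u : 'I_r -> F) w :
  \det (moore r u w) = frob w (\det (moore r u 0)).
Proof. by rewrite -[w in LHS]addn0 moore_frob det_map_mx. Qed.

(** Expanding the trace gives the case e = 0.  A column of V is removed by Laplace
    expansion; the cofactors do not involve it, and they have the same shape on one
    row less.  T is meant for an additive group on which the trace form vanishes. *)
Lemma laplace_moore (T : F -> Prop) (a : F) r :
    (forall u : 'I_r -> F, (forall i, T (u i)) -> Tr (a * \det (moore r u 0)) = 0) ->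
  forall e (u : 'I_(e + r) -> F) (V : 'M[F]_(e + r, e)), (forall i, T (u i)) ->
  \sum_(w < m) frob w a * \det (row_mx V (moore r u w)) = 0.
Proof.
move=> hT; elim=> [|e IH] u V Tu.
  rewrite -[RHS](hT u Tu) (TrE hF); apply: eq_bigr => w _.
  rewrite row_thin_mx rmorphM /=; congr (_ * _); exact: det_moore_frob.
transitivity (\sum_(i < e.+1 + r) \sum_(w < m)
   (V i 0 * (-1) ^+ i) * (frob w a * \det (row_mx (row' i (col' 0 V)) (moore r (u \o lift i) w)))).
  rewrite exchange_big; apply: eq_bigr => w _ /=.
  rewrite (expand_det_col _ (lshift r (0 : 'I_e.+1))) mulr_sumr; apply: eq_bigr => i _.
  rewrite row_mxEl /cofactor /= addn0.
  rewrite col'Kl row'_row_mx.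
  rewrite (_ : row' i (moore r u w) = moore r (u \o lift i) w); first by ring.
  by apply/matrixP => x y; rewrite !mxE.
by apply: big1 => i _; rewrite -mulr_sumr (IH (u \o lift i)) ?mulr0 // => j; apply: Tu.
Qed.


Section Windows.
Variables (d : nat) (b : 'I_d -> F).
Hypothesis b_free : \det (moore d b 0) != 0.

(** The functional z on the columns X_t = (b_i^(2^t)); it is periodic in t modulo m. *)
Definition ev (z : 'rV[F]_d) (t : nat) : F := \sum_i z 0 i * frob t (b i).

Lemma ev_eqm z s t : s = t %[mod m] -> ev z s = ev z t.
Proof. by move=> e; apply: eq_bigr => i _; rewrite (frob_eqm hF _ e). Qed.

Lemma ev_comb x y z1 z2 t : ev (x *: z1 + y *: z2) t = x * ev z1 t + y * ev z2 t.
Proof.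
by rewrite /ev !mulr_sumr -big_split; apply: eq_bigr => i _; rewrite !mxE mulrDl !mulrA.
Qed.

Lemma moore_unit j : moore d b j \in unitmx.
Proof. by rewrite unitmxE unitfE det_moore_frob fmorph_eq0. Qed.

Lemma evE z j (f : 'I_d) : ev z (j + f) = (z *m moore d b j) 0 f.
Proof. by rewrite !mxE; apply: eq_bigr => i _; rewrite !mxE. Qed.

(** d consecutive columns form a Frobenius twist of the Moore matrix, hence a basis. *)
Lemma window_eq0 z j : (forall f, (f < d)%N -> ev z (j + f) = 0) -> z = 0.
Proof.
move=> h; rewrite -[z](mulmxK (moore_unit j)).
suff -> : z *m moore d b j = 0 by rewrite mul0mx.
by apply/rowP => f; rewrite -evE h // mxE.
Qed.

Lemma window_interp j (y : nat -> F) :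
  exists z, forall f, (f < d)%N -> ev z (j + f) = y f.
Proof.
exists ((\row_f y f) *m invmx (moore d b j)) => f lf.
by rewrite (evE _ _ (Ordinal lf)) mulmxKV ?moore_unit // mxE.
Qed.

(** Decompose z along the basis dual to the window at j: it vanishes at t if each
    basis functional that occurs in z does. *)
Lemma window_combine j t z :
    (forall f, (f < d)%N -> ev z (j + f) != 0 ->
      forall z', (forall f', (f' < d)%N -> f' != f -> ev z' (j + f') = 0) ->
      ev z' t = 0) ->
  ev z t = 0.
Proof.
move=> h; pose y := z *m moore d b j.
rewrite -(mulmxK (moore_unit j) z) -/y.
have -> : ev (y *m invmx (moore d b j)) t =
    \sum_f y 0 f * ev (row f (invmx (moore d b j))) t.
  transitivity (\sum_i \sum_f y 0 f * invmx (moore d b j) f i * frob t (b i)).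
    by apply: eq_bigr => i _; rewrite mxE mulr_suml.
  rewrite exchange_big; apply: eq_bigr => f _; rewrite mulr_sumr.
  by apply: eq_bigr => i _; rewrite !mxE mulrA.
apply: big1 => f _; have [->|nf] := eqVneq (y 0 f) 0; first by rewrite mul0r.
rewrite (h f) ?mulr0 // ?evE // => f' lf' ne.
rewrite (evE _ _ (Ordinal lf')) -row_mul mulVmx ?moore_unit // !mxE.
by case: eqP => // e; rewrite e eqxx in ne.
Qed.

End Windows.

(** With the columns X_(j+s), s in S, as V, each window that meets S repeats a
    column.  The remaining window must have determinant 0, and z is a vector of the
    left kernel. *)
Lemma window_elimination e r (b : 'I_(e + r) -> F) (a : F) (S : seq nat) j j0 :
    a != 0 ->
    (forall V, \sum_(w < m) frob w a * \det (row_mx V (moore r b w)) = 0) ->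
    size S = e -> (j0 < m)%N ->
    (forall x, (x < m)%N -> x != j0 ->
       exists c s, [/\ (c < r)%N, s \in S & x + c = s %[mod m]]) ->
  exists2 z, z != 0 & forall t, t \in S ++ iota j0 r -> ev b z (j + t) = 0.
Proof.
move=> na hV sS lj0 hS; have m0 := m_gt0 hF.
pose V := \matrix_(i < e + r, c < e) frob (j + nth 0%N S c) (b i).
have lw0 : ((j + j0) %% m < m)%N by rewrite ltn_mod.
have := hV V; rewrite (bigD1 (Ordinal lw0)) //= big1 ?addr0.
  move/eqP; rewrite mulf_eq0 fmorph_eq0 (negbTE na) /= => /det0P [z nz hz].
  exists z => // t; rewrite mem_cat => /orP [/(nthP 0%N) [c]|].
    rewrite sS => lc <-; move/rowP/(_ (lshift r (Ordinal lc))): hz.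
    rewrite mul_mx_row row_mxEl !mxE => <-.
    by apply: eq_bigr => i _; rewrite !mxE.
  rewrite mem_iota => /andP [h1 h2].
  have lc : (t - j0 < r)%N by lia.
  move/rowP/(_ (rshift e (Ordinal lc))): hz.
  rewrite mul_mx_row row_mxEr !mxE => <-.
  rewrite (_ : (j + t = j + j0 + (t - j0))%N); last lia.
  apply: eq_bigr => i _; rewrite !mxE /=; congr (_ * _).
  by apply: frob_eqm; rewrite modnDml.
move=> w /eqP nw.
pose x := ((w + m.-1 * j) %% m)%N.
have hx : (j + x = w %[mod m])%N.
  by rewrite /x modnDmr addnCA -mulSn prednK // addnC mulnC modnMDl.
have lx : (x < m)%N by rewrite ltn_mod.
have nx : x != j0.
  apply/eqP => xj; apply: nw; apply: val_inj => /=.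
  by rewrite -xj hx modn_small.
have [c [s [lc /(nthP 0%N) [c'] ]]] := hS x lx nx; rewrite sS => lc' <- h.
rewrite -det_tr (@determinant_alternate _ _ _ (lshift r (Ordinal lc')) (rshift e (Ordinal lc))) ?mulr0 //.
  by rewrite eq_lrshift.
move=> i; rewrite [LHS]mxE [RHS]mxE row_mxEl row_mxEr !mxE /=.
apply: frob_eqm; rewrite -modnDmr -h modnDmr addnA -modnDml hx modnDml //.
Qed.

End Moore.

(** * Isotropic spaces of high degree *)

Section Large.
Variables (F : finFieldType) (m : nat).
Hypothesis hF : #|F| = (2 ^ m)%N.
Local Notation frob := (frobenius (pchar2 hF)).

Variables (e r : nat) (b : 'I_(e + r) -> F) (a : F).
Local Notation d := (e + r)%N.
Local Notation ev := (ev hF b).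
Hypothesis b_free : \det (moore hF d b 0) != 0.
Hypothesis a_neq0 : a != 0.
Hypothesis hV : forall V, \sum_(w < m) frob w a * \det (row_mx V (moore hF r b w)) = 0.
Hypotheses (hdm : (d <= m)%N) (he : (2 <= e)%N) (hr : (e <= r)%N) (hd : (m + 3 <= d.*2)%N).

(** The window [1, r] and S = {0} with [r + 1, d) make up d consecutive exponents.
    Every other window meets S: the m - d exponents outside are too few for one. *)
Lemma long_window_absurd : (m < d + r)%N -> False.
Proof.
move=> hmr.
have [|||z nz hz] := @window_elimination F m hF e r b a (0%N :: iota r.+1 e.-1) 0 1 a_neq0 hV.
- by rewrite /= size_iota; lia.
- lia.
- move=> x lx nx; have [x0|[h|[h|h]]] : (x = 0 \/ (2 <= x <= r.+1) \/ (r.+2 <= x < d) \/ d <= x)%N by lia.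
  + by exists 0%N, 0%N; rewrite x0 inE; split=> //; lia.
  + exists (r.+1 - x)%N, r.+1; rewrite inE mem_iota; split; [lia|lia|congr (_ %% _)%N; lia].
  + exists 0%N, x; rewrite inE mem_iota; split; [lia|lia|congr (_ %% _)%N; lia].
  + exists (m - x)%N, 0%N; rewrite inE; split; [lia|by []|].
    by rewrite subnKC ?(ltnW lx) // modnn mod0n.
case/eqP: nz; apply: (window_eq0 (hF := hF) b_free (j := 0)) => f lf; apply: hz.
by rewrite mem_cat inE !mem_iota; lia.
Qed.

(** Take S to consist of [0, d) without the window [d - 1 - r, d - 1) and without f, and
    of d + i.  The bounds make every other window meet S: [d, d + i) is too short for
    one, and so is (d + i, m), even when it is continued by the missing f = 0.  Hence the
    columns at [0, d) without f and the one at d + i are dependent, and the functional dual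
    to f vanishes at d + i. *)
Lemma functional_exchange j f i z :
    (d + r <= m)%N -> (f + r + 3 <= d)%N -> (d + i < m)%N -> (i < r)%N ->
    (m <= d + i + r)%N -> (f = 0%N -> (m < d + i + r)%N) ->
    (forall f', (f' < d)%N -> f' != f -> ev z (j + f') = 0) ->
  ev z (j + (d + i)) = 0.
Proof.
move=> hk hf him hir hi hf0 hz.
have [||| y ny hy] := @window_elimination F m hF e r b a
    (iota 0 f ++ iota f.+1 (d - 2 - r - f) ++ [:: d.-1; (d + i)%N]) j (d - 1 - r) a_neq0 hV.
- by rewrite !size_cat /= !size_iota; lia.
- lia.
- move=> x lx nx.
  have mS s : (s \in iota 0 f ++ iota f.+1 (d - 2 - r - f) ++ [:: d.-1; (d + i)%N])
      = (s < d - 1 - r)%N && (s != f) || (s == d.-1) || (s == d + i)%N.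
    by rewrite !mem_cat !mem_iota !inE; lia.
  have wit c s : (c < r)%N ->
      (s < d - 1 - r)%N && (s != f) || (s == d.-1) || (s == d + i)%N ->
      (x + c = s \/ x + c = m + s)%N ->
      exists c s, [/\ (c < r)%N, s \in iota 0 f ++ iota f.+1 (d - 2 - r - f) ++ [:: d.-1; (d + i)%N]
        & x + c = s %[mod m]]%N.
    move=> lc hs hx; exists c, s; rewrite mS; split => //.
    by case: hx => ->; rewrite ?modnDl.
  have [h|[h|[h|h]]] : (x + r <= d - 2 - r \/ (d - 2 - r < x + r /\ x <= d - 2 - r)
      \/ (d - r <= x <= d.-1) \/ d <= x)%N by lia.
  + have [xf|xf] := eqVneq x f; first by apply: (wit 1%N x.+1); lia.
    by apply: (wit 0%N x); lia.
  + by apply: (wit (d - 2 - r - x)%N (d - 2 - r)%N); lia.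
  + by apply: (wit (d.-1 - x)%N d.-1); lia.
  + have [h'|h'] := leqP x (d + i).
      by apply: (wit (d + i - x)%N (d + i)%N); lia.
    have [f0|f0] := eqVneq f 0%N; first by have := hf0 f0; move=> ?; apply: (wit (m - x).+1 1%N); lia.
    by apply: (wit (m - x)%N 0%N); lia.
have mS s : (s < d)%N -> s != f -> ev y (j + s) = 0.
  by move=> ls ns; apply: hy; rewrite !mem_cat !mem_iota !inE; lia.
have yt : ev y (j + (d + i)) = 0 by apply: hy; rewrite !mem_cat !inE eqxx !orbT.
have yf : ev y (j + f) != 0.
  apply: contraNneq ny => yf; apply/eqP.
  apply: (window_eq0 (hF := hF) b_free (j := j)) => s ls.
  by have [->|] := eqVneq s f; last exact: mS.
have e0 : ev y (j + f) *: z + (- ev z (j + f)) *: y = 0.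
  apply: (window_eq0 (hF := hF) b_free (j := j)) => s ls; rewrite ev_comb.
  have [->|ns] := eqVneq s f; first by rewrite mulNr mulrC subrr.
  by rewrite (mS s) // (hz s) // !mulr0 addr0.
have := ev_comb hF b (ev y (j + f)) (- ev z (j + f)) z y (j + (d + i)).
rewrite e0 yt mulr0 addr0 /ev big1 => [|s _]; last by rewrite mxE mul0r.
by move/esym/eqP; rewrite mulf_eq0 (negbTE yf) => /eqP.
Qed.

Lemma ev0 t : ev 0 t = 0.
Proof. by apply: big1 => i _; rewrite mxE mul0r. Qed.

(** Let k = m - d be the number of exponents outside a window of length d, with r <= k.
    If d > k + 3, the exchange lemma makes X_(d+i), i = k - r + 1, a
    combination of the columns at (i, d), which belong to the same window.  If d = k + 3
    and r < k, the same contradiction comes from two overlapping windows.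
    If r = k, each functional dual to the first column of a window has support {j, j + d}.
    As 2d = m + 3, combining two of them gives the support {0, 3}, which leaves a
    free window of length m - 4.  This is at least d except for k = 3, that is m = 9. *)
Lemma isotropic_for_moore_absurd : m != 9%N -> False.
Proof.
move=> m9; have [/long_window_absurd //|hk] := ltnP m (d + r).
have [k mk] : exists k, m = (d + k)%N by exists (m - d)%N; lia.
have [d4|d3] := ltnP (k + 3) d.
  (* the window at k - r + 2 consists of the columns at (i, d) and those up to d + i *)
  have [z hz] := window_interp (hF := hF) b_free (k - r + 2)%N (fun f => (f == d.-1)%:R).
  have : ev z (0 + (d + (k - r).+1)) = 0.
    apply: (window_combine (hF := hF) b_free (j := 0)) => f lf.
    have [fi _ z' hz'|fi] := leqP f (k - r).+1.
      by apply: (functional_exchange (f := f)) => //; lia.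
    rewrite (_ : (0 + f = k - r + 2 + (f - (k - r + 2)))%N) ?hz; try lia.
    by rewrite (_ : (_ == (e + r).-1) = false) ?eqxx //; lia.
  rewrite (_ : (0 + _ = k - r + 2 + d.-1)%N) ?hz; try lia.
  by rewrite eqxx => /eqP; rewrite oner_eq0.
have dk : (d = k + 3)%N by lia.
have [rk|rk] := ltnP r k.
  pose i := (k - r)%N.
  have B z : (forall t, (i.+1 <= t < d)%N -> ev z t = 0) -> ev z (0 + (d + i.+1)) = 0.
    move=> hz; apply: (window_combine (hF := hF) b_free (j := 0)) => f lf.
    have [fi _ z' hz'|fi] := leqP f i.
      by apply: (functional_exchange (f := f)) => //; lia.
    by rewrite hz ?eqxx //; lia.
  have [z hz] := window_interp (hF := hF) b_free (i + 2)%N (fun f => (f == d.-1)%:R).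
  have : ev z (1 + (d + i)) = 0.
    apply: (window_combine (hF := hF) b_free (j := 1)) => f lf.
    have [fi|fi] := leqP f i; last first.
      rewrite (_ : (1 + f = i + 2 + (f.+1 - (i + 2)))%N) ?hz; try lia.
      by rewrite (_ : (_ == (e + r).-1) = false) ?eqxx //; lia.
    move=> _ z' hz'; have [f0|f0] := eqVneq f 0%N.
      rewrite (_ : (1 + (d + i) = 0 + (d + i.+1))%N); last lia.
      apply: B => t lt; rewrite (_ : t = 1 + t.-1)%N; last lia.
      by apply: hz'; lia.
    by apply: (functional_exchange (f := f)) => //; lia.
  rewrite (_ : (1 + _ = i + 2 + d.-1)%N) ?hz; try lia.
  by rewrite eqxx => /eqP; rewrite oner_eq0.
(* now r = k and m = 2k + 3; y has support {0, d} and z has support {d, 2d} = {d, 3} *)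
have E j z i : (1 <= i)%N -> (i < k)%N ->
    (forall f', (f' < d)%N -> f' != 0%N -> ev z (j + f') = 0) ->
    ev z (j + (d + i)) = 0.
  by move=> i1 ik; apply: functional_exchange; lia.
have [y hy] := window_interp (hF := hF) b_free 0 (fun f => (f == 0%N)%:R).
have [z hz] := window_interp (hF := hF) b_free d (fun f => (f == 0%N)%:R).
have y0 t : (1 <= t)%N -> (t != d)%N -> (t < m)%N -> ev y t = 0.
  move=> t1 td tm; have [ltd|gtd] := ltnP t d.
    by rewrite -[t]add0n hy //; case: t t1 {td tm ltd}.
  rewrite (_ : t = 0 + (d + (t - d)))%N; last lia.
  apply: E; [lia|lia|move=> f lf nf; rewrite hy // (negbTE nf) //].
have z0 t : (1 <= t)%N -> (t != d)%N -> (t < m + d)%N -> (t != m + 3)%N -> (d <= t)%N -> ev z t = 0.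
  move=> t1 td tm t3 dt; have [ltd|gtd] := ltnP t (d + d).
    rewrite (_ : t = d + (t - d))%N; last lia.
    by rewrite hz; [rewrite (_ : (_ == _) = false) //; lia|lia].
  rewrite (_ : t = d + (d + (t - (d + d))))%N; last lia.
  by apply: E; [lia|lia|move=> f lf nf; rewrite hz // (negbTE nf)].
have zm t : ev z (t + m) = ev z t by apply: ev_eqm; rewrite modnDr.
have yz : 1 *: y + (- ev y d) *: z = 0.
  apply: (window_eq0 (hF := hF) b_free (j := 4)) => f lf; rewrite ev_comb mul1r.
  have [fd|fd] := eqVneq (4 + f)%N d.
    have := hz 0%N; rewrite addn0 eqxx fd => ->; last lia.
    by rewrite mulr1 subrr.
  rewrite y0 ?add0r; [|lia..].
  have [h|h] := ltnP (4 + f) d; [rewrite -zm|]; by rewrite z0 ?mulr0 //; lia.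
have := ev_comb hF b 1 (- ev y d) y z (0 + 0).
rewrite yz ev0 hy ?eqxx ?mulr1; last lia.
rewrite -zm z0 ?mulr0 ?addr0; [|lia..].
by move/esym/eqP; rewrite oner_eq0.
Qed.

End Large.

(** * The dual basis *)

Section Duality.
Variables (F : finFieldType) (m : nat).
Hypothesis hF : #|F| = (2 ^ m)%N.
Local Notation frob := (frobenius (pchar2 hF)).

(** The Boolean cube stands for the coordinate space over F_2. *)
Definition bspan d (b : 'I_d -> F) (c : {ffun 'I_d -> bool}) : F :=
  \sum_i (c i)%:R * b i.

Definition in_span d (b : 'I_d -> F) (x : F) : Prop := exists c, x = bspan b c.

Lemma mem_span d (b : 'I_d -> F) i : in_span b (b i).
Proof.
exists [ffun j => j == i]; rewrite /bspan (bigD1 i) //= ffunE eqxx mul1r.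
by rewrite big1 ?addr0 // => j /negbTE nj; rewrite ffunE nj mul0r.
Qed.

Section Dual.
Variables (d : nat) (b : 'I_d -> F).

Definition dual_basis (z : 'I_d -> F) : Prop :=
  forall l, (l < d)%N -> \sum_i z i * frob l (b i) = (l == 0%N)%:R.

Lemma dual_basis_exists : \det (moore hF d b 0) != 0 -> exists z, dual_basis z.
Proof.
move=> b_free; have [z hz] := window_interp b_free 0 (fun l => (l == 0%N)%:R).
by exists (z 0) => l ld; rewrite -[RHS]hz.
Qed.

(** Frobenius twists of the defining equations.  They only reach d consecutive
    exponents, hence the triangular matrices below. *)
Lemma dual_basis_shift z i j : dual_basis z -> (i <= j)%N -> (j < i + d)%N ->
  \sum_t frob i (z t) * frob j (b t) = (i == j)%:R.
Proof.
move=> hz ij jd; rewrite -[RHS](frob_bool hF i).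
rewrite (_ : (i == j) = (j - i == 0)%N) -?hz; [|lia..].
rewrite rmorph_sum; apply: eq_bigr => t _.
by rewrite rmorphM /= frob_frob subnKC.
Qed.

Lemma det_dual_basis z : dual_basis z ->
  \det (moore hF d z 0) * \det (moore hF d b 0) = 1.
Proof.
move=> hz; rewrite -[\det (moore _ _ z _)]det_tr -det_mulmx det_trig.
  apply: big1 => i _; rewrite !mxE; transitivity ((i == i :> nat)%:R : F); last by rewrite eqxx.
  rewrite -(dual_basis_shift hz (leqnn i)); last by have := ltn_ord i; lia.
  by apply: eq_bigr => t _; rewrite !mxE.
apply/is_trig_mxP => i j ij; rewrite !mxE.
transitivity ((i == j :> nat)%:R : F); last by rewrite ltn_eqF.
rewrite -(dual_basis_shift hz (ltnW ij)); last by have := ltn_ord j; lia.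
by apply: eq_bigr => t _; rewrite !mxE.
Qed.

End Dual.

(** Multiplying [C | X_e, ..., X_(d-1)] by the Moore matrix of the dual basis gives a
    block triangular matrix: the dual basis pairs with the last r columns
    unitriangularly, and with C it gives the Moore matrix of the combinations of z
    with coefficients C. *)
Lemma dual_minor e r (b z : 'I_(e + r) -> F) (c : 'I_e -> {ffun 'I_(e + r) -> bool}) :
    dual_basis b z ->
  frob e (\det (row_mx (\matrix_(i, j) (c j i)%:R) (moore hF r b 0)))
  = \det (moore hF (e + r) b 0) * \det (moore hF e (fun j => bspan z (c j)) 0).
Proof.
move=> hz; set W := row_mx _ _.
have hW : map_mx (frob e) W = row_mx (\matrix_(i, j) (c j i)%:R) (moore hF r b e).
  rewrite map_row_mx -moore_frob addn0; congr (row_mx _ _).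
  by apply/matrixP => i j; rewrite !mxE frob_bool.
suff h : (moore hF (e + r) z 0)^T *m map_mx (frob e) W =
    block_mx (moore hF e (fun j => bspan z (c j)) 0)^T 0
      (dsubmx (moore hF (e + r) z 0)^T *m (\matrix_(i, j) (c j i)%:R))
      (dsubmx (moore hF (e + r) z 0)^T *m moore hF r b e).
  have /(congr1 determinant) := h.
  rewrite det_mulmx det_tr det_map_mx det_lblock det_tr [\det (dsubmx _ *m moore _ _ _ _)]det_trig.
    rewrite big1 => [|i _]; last first.
      rewrite !mxE; transitivity ((e + i == e + i)%N%:R : F); last by rewrite eqxx.
      rewrite -(dual_basis_shift hz (leqnn (e + i))); last by have := ltn_ord i; lia.
      by apply: eq_bigr => t _; rewrite !mxE.
    rewrite mulr1 => <-; rewrite mulrCA mulrA [_ * \det (moore hF (e + r) b 0)]mulrC -[LHS]mul1r.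
    by rewrite -(det_dual_basis hz); ring.
  apply/is_trig_mxP => i j ij; rewrite !mxE.
  transitivity ((e + i == e + j)%N%:R : F); last by rewrite eqn_add2l ltn_eqF.
  rewrite -(dual_basis_shift hz); [|lia|by have := ltn_ord j; lia].
  by apply: eq_bigr => t _; rewrite !mxE.
rewrite hW -[(moore _ _ z _)^T in LHS]vsubmxK mul_col_row; congr block_mx.
  apply/matrixP => l j; rewrite !mxE /bspan rmorph_sum; apply: eq_bigr => t _.
  by rewrite !mxE rmorphM /= frob_bool mulrC.
apply/matrixP => l j; rewrite !mxE.
transitivity ((l == e + j :> nat)%:R : F); last first.
  by rewrite (_ : (l == _ :> nat) = false) //; have := ltn_ord l; lia.
rewrite -(dual_basis_shift hz); [|by have := ltn_ord l; lia|by have := ltn_ord j; lia].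
by apply: eq_bigr => t _; rewrite !mxE.
Qed.

Lemma det_moore_cast n n' (eq_n : n' = n) (u : 'I_n -> F) :
  \det (moore hF n' (u \o cast_ord eq_n) 0) = \det (moore hF n u 0).
Proof.
case: n / eq_n u => u; congr (\det _).
by apply/matrixP => i j; rewrite !mxE /= cast_ord_id.
Qed.

(** The trace form of degree r cannot vanish on a large space.  For r below half the
    dimension, the vanishing is moved to the dual space, where the degree is e. *)
Theorem moore_form_not_isotropic e r (b : 'I_(e + r) -> F) (a : F) :
    \det (moore hF (e + r) b 0) != 0 -> a != 0 ->
    (e + r <= m)%N -> (2 <= e)%N -> (2 <= r)%N -> (m + 3 <= (e + r).*2)%N -> m != 9%N ->
    (forall u : 'I_r -> F, (forall i, in_span b (u i)) -> Tr (a * \det (moore hF r u 0)) = 0) ->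
  False.
Proof.
move=> fb na hm he hr hd m9 hT.
have hV := laplace_moore hT _ (mem_span b).
have [er|re] := leqP e r; first exact: isotropic_for_moore_absurd fb na hV hm he er hd m9.
have [z hz] := dual_basis_exists fb.
pose z' := z \o cast_ord (addnC r e).
have fz : \det (moore hF (r + e) z' 0) != 0.
  rewrite det_moore_cast; apply/eqP => z0.
  by have := det_dual_basis hz; rewrite z0 mul0r => /esym/eqP; rewrite oner_eq0.
have na' : frob e a * \det (moore hF (e + r) b 0) != 0.
  by rewrite mulf_neq0 // fmorph_eq0.
have hT' (u : 'I_e -> F) : (forall i, in_span z' (u i)) ->
    Tr (frob e a * \det (moore hF (e + r) b 0) * \det (moore hF e u 0)) = 0.
  move=> hu; have [c hc] := fin_all_exists hu.
  pose c' j : {ffun 'I_(e + r) -> bool} := [ffun i => c j (cast_ord (addnC e r) i)].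
  have -> : moore hF e u 0 = moore hF e (fun j => bspan z (c' j)) 0.
    apply/matrixP => i j; rewrite !mxE hc; congr (frobenius _ _ _).
    rewrite /bspan (reindex (cast_ord (addnC e r))) /=; last first.
      by exists (cast_ord (addnC r e)) => t _; apply: val_inj.
    apply: eq_bigr => t _; rewrite ffunE /z' /=; congr (_ * z _).
    exact: val_inj.
  rewrite -mulrA -dual_minor // -rmorphM /= (Tr_frob hF) (TrE hF).
  rewrite -[RHS](hV (\matrix_(i, j) (c' j i)%:R)); apply: eq_bigr => w _.
  rewrite rmorphM -det_map_mx; congr (_ * \det _).
  rewrite map_row_mx -moore_frob addn0; congr (row_mx _ _).
  by apply/matrixP => i j; rewrite !mxE rmorph_nat.
have hV' := laplace_moore hT' _ (mem_span z').
by apply: isotropic_for_moore_absurd fz na' hV' _ _ _ _ m9; lia.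
Qed.

End Duality.

(** * Additive subgroups and their bases *)

Section Subgroups.
Variables (F : finFieldType) (m : nat).
Hypothesis hF : #|F| = (2 ^ m)%N.
Local Notation frob := (frobenius (pchar2 hF)).

Lemma zmod_closed_0 (A : {set F}) : zmod_closed A -> 0 \in A.
Proof. by case. Qed.

Lemma zmod_closed_add (A : {set F}) x y : zmod_closed A -> x \in A -> y \in A -> x + y \in A.
Proof. by case=> _ h hx hy; rewrite -(oppx hF y); apply: h. Qed.

Lemma zmod_closed_addr (A : {set F}) x y : zmod_closed A -> x \in A -> (x + y \in A) = (y \in A).
Proof.
move=> hA hx; apply/idP/idP => h; last exact: zmod_closed_add.
by rewrite -[y]add0r -(addxx hF x) -addrA; apply: zmod_closed_add.
Qed.

Lemma card_half (B : {set F}) (g : F -> F) :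
    zmod_closed B -> {morph g : x y / x + y} -> (forall x, g x = 0 \/ g x = 1) ->
    (exists2 x, x \in B & g x = 1) ->
  (#|[set x in B | g x == 0%R]| * 2 = #|B|)%N.
Proof.
move=> hB gD g01 [x0 Bx0 gx0].
have -> : #|B| = (#|[set x in B | g x == 0%R]| + #|[set x in B | g x == 1%R]|)%N.
  rewrite -[LHS](cardsID [set x | g x == 0]); congr (_ + _)%N.
    by apply: eq_card => x; rewrite !inE andbC.
  apply: eq_card => x; rewrite !inE andbC; congr andb.
  by case: (g01 x) => ->; rewrite ?eqxx ?oner_eq0 // eq_sym oner_eq0.
rewrite muln2 -addnn; congr (_ + _)%N.
rewrite -(card_imset _ (addrI x0)); apply: eq_card => x.
rewrite inE; apply/imsetP/andP => [[y]|[Bx gx]].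
  rewrite inE => /andP [By /eqP gy] ->.
  by rewrite zmod_closed_addr // By gD gx0 gy addr0.
exists (x0 + x); last by rewrite addrA (addxx hF) add0r.
by rewrite inE zmod_closed_addr // Bx gD gx0 (eqP gx) (addxx hF) eqxx.
Qed.

Definition perp (A : {set F}) : {set F} := [set c | [forall x in A, Tr (c * x) == 0]].

Lemma perpP (A : {set F}) c : reflect (forall x, x \in A -> Tr (c * x) = 0) (c \in perp A).
Proof.
rewrite inE; apply: (iffP forall_inP) => h x hx; first exact/eqP/h.
by apply/eqP/h.
Qed.

Lemma Tr_0_or_1 (x : F) : Tr x = 0 \/ Tr x = 1.
Proof. by case/orP: (Tr01 hF x) => /eqP; [left|right]. Qed.

Lemma zmod_closed_setT : zmod_closed [set: F].
Proof. by split=> [|x y _ _]; rewrite inE. Qed.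

(** Count the pairs (c, x) with x in A and Tr(c x) = 0 in two ways; each nonzero
    additive functional vanishes on half of its domain. *)
Lemma card_perp (A : {set F}) : zmod_closed A -> (#|A| * #|perp A| = 2 ^ m)%N.
Proof.
move=> hA; have A0 := zmod_closed_0 hA.
pose N := (\sum_(c : F) \sum_(x in A) (Tr (c * x)%R == 0%R))%N.
have N1 : (N * 2 = #|A| * #|F| + #|A| * #|perp A|)%N.
  rewrite /N big_distrl /= (eq_bigr (fun c => #|A| + (c \in perp A) * #|A|)%N) => [|c _].
    rewrite big_split sum_nat_const -big_distrl /= mulnC; congr (_ + _)%N.
    by rewrite mulnC -[in LHS]big_mkcond sum1_card; congr (_ * _)%N; apply: eq_card.
  rewrite -big_mkcondr sum1_card.
  have [hc|hc] := boolP (c \in perp A).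
    rewrite mul1n addnn -muln2; congr (_ * _)%N; apply: eq_card => x; rewrite unfold_in.
    by case hx: (x \in A) => //=; rewrite (perpP _ _ hc) ?eqxx.
  rewrite mul0n addn0 -(@card_half A (fun x => Tr (c * x))) //.
  - by congr (_ * _)%N; apply: eq_card => x; rewrite !inE unfold_in.
  - by move=> x y; rewrite mulrDr (TrD hF).
  - by move=> x; apply: Tr_0_or_1.
  - move: hc; rewrite inE negb_forall => /existsP [x]; rewrite negb_imply => /andP [Ax].
    by rewrite (Tr_neq0 hF) => /eqP h; exists x.
have N2 : (N * 2 = #|A| * #|F| + #|F|)%N.
  rewrite /N exchange_big big_distrl /= (bigD1 0) //=.
  rewrite (eq_bigr (fun=> 1%N)) => [|c _]; last by rewrite mulr0 (Tr0 hF) eqxx.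
  rewrite sum1_card (eq_bigr (fun=> #|F|)) => [|x /andP [Ax nx]]; last first.
    rewrite -big_mkcond sum1_card -[RHS]cardsT.
    rewrite -(@card_half [set: F] (fun c => Tr (c * x)) zmod_closed_setT).
    - by congr (_ * _)%N; apply: eq_card => y; rewrite !inE.
    - by move=> y z; rewrite mulrDl (TrD hF).
    - by move=> y; apply: Tr_0_or_1.
    - by have [y hy] := Tr_nondeg hF nx; exists y; rewrite ?inE // mulrC.
  rewrite sum_nat_const.
  have -> : #|(fun i : F => (i \in A) && (i != 0))| = #|A|.-1.
    by rewrite (cardD1 0 A) A0 /=; apply: eq_card => x; rewrite !inE andbC.
  have : (0 < #|A|)%N by apply/card_gt0P; exists 0.
  rewrite (_ : #|xpredT| = #|F|) //; case: #|A| => // n _ /=; lia.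
rewrite -hF; lia.
Qed.

Lemma bspan_xor d (b : 'I_d -> F) c c' :
  bspan b c + bspan b c' = bspan b [ffun i => c i (+) c' i].
Proof.
rewrite /bspan -big_split; apply: eq_bigr => i _ /=; rewrite ffunE -mulrDl.
by case: (c i) (c' i) => [] [] /=; rewrite ?addr0 ?add0r ?(addxx hF).
Qed.

Lemma bspan_in (A : {set F}) d (b : 'I_d -> F) c :
  zmod_closed A -> (forall i, b i \in A) -> bspan b c \in A.
Proof.
move=> hA hb; apply: (big_ind (fun x => x \in A)).
- exact: zmod_closed_0.
- by move=> x y; apply: zmod_closed_add.
- by move=> i _; case: (c i); rewrite ?mul1r ?mul0r ?zmod_closed_0.
Qed.

Lemma bspan_inj d (b : 'I_d -> F) :
  (forall c, bspan b c = 0 -> c = [ffun=> false]) -> injective (bspan b).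
Proof.
move=> hb c c' /eqP; rewrite -(addr_eq0_2 hF) bspan_xor => /eqP /hb /ffunP h.
by apply/ffunP => i; have := h i; rewrite !ffunE; case: (c i) (c' i) => [] [].
Qed.

Lemma card_cube d : #|{: {ffun 'I_d -> bool}}| = (2 ^ d)%N.
Proof. by rewrite card_ffun card_bool card_ord. Qed.

(** e elements have at most 2^e combinations, so the basis can be extended as
    long as e < d. *)
Lemma zmod_closed_basis (A : {set F}) d : zmod_closed A -> #|A| = (2 ^ d)%N ->
  exists b : 'I_d -> F, (forall i, b i \in A) /\
    (forall c, bspan b c = 0 -> c = [ffun=> false]).
Proof.
move=> hA cA; suff h e : (e <= d)%N -> exists b : 'I_e -> F, (forall i, b i \in A) /\
    (forall c, bspan b c = 0 -> c = [ffun=> false]) by apply: h.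
elim: e => [_|e IH ed].
  by exists (fun=> 0); split=> [[] //|c _]; apply/ffunP => -[].
have [b [bA hb]] := IH (ltnW ed).
have [x Ax nx] : exists2 x, x \in A & x \notin codom (bspan b).
  apply/exists_inP; apply: contraT; rewrite negb_exists_in => /forall_inP h.
  have : (#|A| <= #|codom (bspan b)|)%N.
    by apply: subset_leq_card; apply/subsetP => x /h; rewrite negbK.
  move/leq_trans/(_ (leq_image_card _ _)); rewrite card_cube cA leq_exp2l //; lia.
pose b' (i : 'I_e.+1) := if unlift ord0 i is Some j then b j else x.
exists b'; split=> [i|c]; first by rewrite /b'; case: unliftP.
have b'0 : b' ord0 = x by rewrite /b' unlift_none.
have b'l j : b' (lift ord0 j) = b j by rewrite /b' liftK.
pose c' : {ffun 'I_e -> bool} := [ffun j => c (lift ord0 j)].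
have -> : bspan b' c = (c ord0)%:R * x + bspan b c'.
  rewrite /bspan big_ord_recl b'0; congr (_ + _); apply: eq_bigr => j _.
  by rewrite b'l ffunE.
case c0: (c ord0).
  rewrite mul1r => /eqP; rewrite (addr_eq0_2 hF) => /eqP xc.
  by rewrite xc codom_f in nx.
rewrite mul0r add0r => /hb /ffunP h; apply/ffunP => i; rewrite ffunE.
by case: (unliftP ord0 i) => [j ->|->] //; have := h j; rewrite !ffunE.
Qed.

(** A linear relation among the columns is an additive polynomial of degree at most
    2^(d-1) with the 2^d combinations of b as roots. *)
Lemma free_det_moore d (b : 'I_d -> F) :
  (forall c, bspan b c = 0 -> c = [ffun=> false]) -> \det (moore hF d b 0) != 0.
Proof.
case: d b => [|d] b hb; first by rewrite det_mx00 oner_eq0.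
rewrite -det_tr; apply/negP => /det0P [v nv hv].
pose p : {poly F} := \sum_(l < d.+1) v 0 l *: 'X^(2 ^ l).
have sp : (size p <= (2 ^ d).+1)%N.
  apply: (leq_trans (size_sum _ _ _)); apply/bigmax_leqP => i _.
  by rewrite (leq_trans (size_scale_leq _ _)) // size_polyXn ltnS leq_exp2l // -ltnS.
have pE x : p.[x] = \sum_(l < d.+1) v 0 l * frob l x.
  by rewrite horner_sum; apply: eq_bigr => l _; rewrite hornerZ hornerXn.
have pb i : p.[b i] = 0.
  move/rowP/(_ i): hv; rewrite !mxE pE => h; rewrite -[RHS]h; apply: eq_bigr => l _.
  by rewrite !mxE.
have p_span c : p.[bspan b c] = 0.
  rewrite pE /bspan (eq_bigr (fun l : 'I_d.+1 => \sum_i (c i)%:R * (v 0 l * frob l (b i)))); last first.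
    move=> l _; rewrite rmorph_sum mulr_sumr; apply: eq_bigr => i _.
    by rewrite rmorphM /= frob_bool; ring.
  rewrite exchange_big big1 // => i _; rewrite -mulr_sumr.
  by have := pb i; rewrite pE => ->; rewrite mulr0.
have np : p != 0.
  apply: contraNneq nv => p0; apply/eqP/rowP => l; rewrite mxE.
  have := congr1 (fun p : {poly F} => p`_(2 ^ l)) p0.
  rewrite coef0 coef_sum (bigD1 l) //= big1 => [|i ni].
    by rewrite coefZ coefXn eqxx mulr1 addr0.
  by rewrite coefZ coefXn eqn_exp2l // eq_sym (negbTE (ni : i != l :> nat)) mulr0.
have := max_poly_roots (rs := codom (bspan b)) np.
rewrite (map_inj_uniq (bspan_inj hb)) enum_uniq size_map -cardE card_cube.
have -> : all (root p) (codom (bspan b)).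
  by apply/allP => x /codomP [c ->]; rewrite rootE p_span.
move=> /(_ isT isT) h; have := leq_trans h sp.
by rewrite ltnS leq_exp2l // ltnn.
Qed.

End Subgroups.

(** * Moments of Moore monomials *)

Section Moments.
Variables (F : finFieldType) (m : nat).
Hypothesis hF : #|F| = (2 ^ m)%N.
Local Notation frob := (frobenius (pchar2 hF)).

Lemma exp_prod_frob l (x : F) : x ^+ (2 ^ l - 1) = \prod_(t < l) frob t x.
Proof.
elim: l => [|l IH]; first by rewrite big_ord0 expr0.
rewrite big_ord_recr /= -IH /frobenius -exprD; congr (_ ^+ _).
by rewrite expnS; have := expn_gt0 2 l; lia.
Qed.

Lemma frob_bspan d (b : 'I_d -> F) c t :
  frob t (bspan b c) = \sum_i (c i)%:R * frob t (b i).
Proof.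
by rewrite rmorph_sum; apply: eq_bigr => i _; rewrite rmorphM /= frob_bool.
Qed.

(** The exponent 2^l - 1 makes the power a product of l Frobenius twists, each linear
    on the cube, so the summand is a product of n + l linear forms. *)
Definition moment d (b : 'I_d -> F) n (V : 'I_n -> 'I_d -> F) l : F :=
  \sum_(c : {ffun 'I_d -> bool})
     (\prod_s \sum_i (c i)%:R * V s i) * bspan b c ^+ (2 ^ l - 1).

Lemma momentE d (b : 'I_d -> F) n (V : 'I_n -> 'I_d -> F) l :
  moment b V l = \sum_(c : {ffun 'I_d -> bool}) \prod_(k < n + l)
     \sum_i (c i)%:R * (match split k with inl s => V s i | inr t => frob t (b i) end).
Proof.
apply: eq_bigr => c _; rewrite big_split_ord /=; congr (_ * _).
  by apply: eq_bigr => s _; apply: eq_bigr => i _; rewrite (unsplitK (inl s)).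
rewrite exp_prod_frob; apply: eq_bigr => t _; rewrite frob_bspan.
by apply: eq_bigr => i _; rewrite (unsplitK (inr t)).
Qed.

Lemma moment_small d (b : 'I_d -> F) n (V : 'I_n -> 'I_d -> F) l :
  (n + l < d)%N -> moment b V l = 0.
Proof. by move=> h; rewrite momentE (cube_sum_small hF). Qed.

Lemma moment_det n l (b : 'I_(n + l) -> F) (V : 'I_n -> 'I_(n + l) -> F) :
  moment b V l = \det (row_mx (\matrix_(i, s) V s i) (moore hF l b 0)).
Proof.
rewrite momentE (cube_sum_det hF); congr (\det _).
by apply/matrixP => i k; rewrite !mxE; case: split => x; rewrite !mxE.
Qed.

End Moments.

Section Polynomials.
Variables (F : finFieldType) (m : nat).
Hypothesis hF : #|F| = (2 ^ m)%N.
Local Notation frob := (frobenius (pchar2 hF)).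

Variables (A : {set F}) (d : nat) (al : nat -> F).
Hypotheses (hA : zmod_closed A) (cA : #|A| = (2 ^ d)%N).
Hypothesis hTr : forall x, x \in A -> x != 0 ->
  Tr (\sum_(l < d) al l * x ^+ (2 ^ l - 1)) = 1.

Let no_form : forall n, 'I_0 -> 'I_n -> F := fun _ _ _ => 0.

Lemma cube_sum_exp n (u : 'I_n -> F) l : (l < n)%N ->
  \sum_(c : {ffun 'I_n -> bool}) bspan u c ^+ (2 ^ l - 1) = 0.
Proof.
move=> ln; rewrite -[RHS](moment_small hF u (no_form (n := n)) (ln : (0 + l < n)%N)).
by apply: eq_bigr => c _; rewrite big_ord0 mul1r.
Qed.

Lemma cube_sum_exp_det n (u : 'I_n -> F) :
  \sum_(c : {ffun 'I_n -> bool}) bspan u c ^+ (2 ^ n - 1) = \det (moore hF n u 0).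
Proof.
have := moment_det hF (n := 0) u (no_form (n := n)).
rewrite row_thin_mx => <-.
by apply: eq_bigr => c _; rewrite big_ord0 mul1r.
Qed.

Lemma cube_sum1 n : (0 < n)%N -> \sum_(c : {ffun 'I_n -> bool}) 1 = 0 :> F.
Proof.
by move=> n0; rewrite -[RHS](cube_sum_exp (fun=> 0) n0); apply: eq_bigr => c _.
Qed.

(** As a Boolean function on A the trace has degree below d, so it sums to 0; being 1
    off 0, it is 1 at 0 too. *)
Lemma Tr_poly_all x : (0 < d)%N -> x \in A ->
  Tr (\sum_(l < d) al l * x ^+ (2 ^ l - 1)) = 1.
Proof.
move=> d0 Ax; have [->|] := eqVneq x 0; last exact: hTr.
have [b [bA hb]] := zmod_closed_basis hF hA cA.
pose f x := Tr (\sum_(l < d) al l * x ^+ (2 ^ l - 1)).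
have s0 : \sum_(c : {ffun 'I_d -> bool}) (f (bspan b c) + 1) = 0.
  rewrite big_split /= cube_sum1 // addr0 -(Tr_sum hF) exchange_big.
  rewrite big1 ?(Tr0 hF) // => l _.
  by rewrite -mulr_sumr cube_sum_exp ?mulr0.
have b0 : bspan b [ffun=> false] = 0.
  by rewrite /bspan big1 // => i _; rewrite ffunE mul0r.
move: s0; rewrite (bigD1 [ffun=> false]) //= b0 big1 ?addr0 => [/eqP|c nc].
  by rewrite (addr_eq0_2 hF) => /eqP.
rewrite /f hTr ?(addxx hF) ?(bspan_in hF _ hA) //.
by apply: contraNneq nc => /hb ->.
Qed.

(** Sum over the combinations of u: exponents below r contribute nothing, and the one
    of index r gives the Moore determinant. *)
Lemma top_moore_trace r : (0 < r)%N -> (r < d)%N -> (forall l, (r < l < d)%N -> al l = 0) ->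
  forall u : 'I_r -> F, (forall i, u i \in A) -> Tr (al r * \det (moore hF r u 0)) = 0.
Proof.
move=> r0 rd hr u hu.
rewrite -[RHS](cube_sum1 r0).
have -> : \sum_(c : {ffun 'I_r -> bool}) 1 = \sum_(c : {ffun 'I_r -> bool})
     Tr (\sum_(l < d) al l * bspan u c ^+ (2 ^ l - 1)).
  by apply: eq_bigr => c _; rewrite Tr_poly_all ?(bspan_in hF _ hA) //; lia.
rewrite -(Tr_sum hF) exchange_big /= (bigD1 (Ordinal rd)) //= -mulr_sumr cube_sum_exp_det.
rewrite big1 ?addr0 // => l nl; rewrite -mulr_sumr.
have [lr|rl] := ltnP l r; first by rewrite cube_sum_exp ?mulr0.
by rewrite hr ?mul0r // ltn_ord andbT ltn_neqAle rl andbT eq_sym.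
Qed.

End Polynomials.

(** * Moments of the inverse function *)

Section Inverses.
Variables (F : finFieldType) (m : nat).
Hypothesis hF : #|F| = (2 ^ m)%N.
Local Notation frob := (frobenius (pchar2 hF)).

Lemma moore_free d (u : 'I_d -> F) c :
  \det (moore hF d u 0) != 0 -> bspan u c = 0 -> c = [ffun=> false].
Proof.
move=> fu u0; have : \row_i (c i)%:R = 0 :> 'rV[F]_d.
  apply: (window_eq0 fu (j := 0)) => l ld.
  rewrite -[RHS](rmorph0 (frob (0 + l))) -u0 /= frob_bspan.
  by apply: eq_bigr => i _; rewrite mxE.
move=> /rowP h; apply/ffunP => i; have := h i; rewrite !mxE ffunE.
by case: (c i) => // /eqP; rewrite oner_eq0.
Qed.

Lemma det_dual_neq0 d (b z : 'I_d -> F) : dual_basis hF b z -> \det (moore hF d z 0) != 0.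
Proof.
move=> hz; apply/eqP => z0; have := det_dual_basis hz.
by rewrite z0 mul0r => /esym/eqP; rewrite oner_eq0.
Qed.

Lemma frob_div l (x : F) : (0 < l)%N -> frob l x / x = x ^+ (2 ^ l - 1).
Proof.
move=> l0; have [->|nx] := eqVneq x 0.
  rewrite rmorph0 mul0r expr0n; case: l l0 => // l _.
  have h : (0 < 2 ^ l)%N by rewrite expn_gt0.
  by rewrite (_ : (_ == _) = false) // expnS; lia.
by rewrite /frobenius -{1}(@subnK 1 (2 ^ l)) ?expn_gt0 // addn1 exprSr mulfK.
Qed.

Variables (d : nat) (b z : 'I_d -> F).
Hypotheses (d0 : (0 < d)%N) (hb : forall c, bspan b c = 0 -> c = [ffun=> false]) (hz : dual_basis hF b z).

Let b_free : \det (moore hF d b 0) != 0 := free_det_moore hF hb.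

Definition pairing (phi c : {ffun 'I_d -> bool}) : F := \sum_i (c i)%:R * (phi i)%:R.

Lemma pairing_sqr phi c : pairing phi c * pairing phi c = pairing phi c.
Proof.
rewrite -expr2 -[LHS]/(frob 1 _) rmorph_sum; apply: eq_bigr => i _.
by rewrite rmorphM /= !frob_bool.
Qed.

Lemma pairing01 phi c : pairing phi c = 0 \/ pairing phi c = 1.
Proof.
have /eqP := pairing_sqr phi c; rewrite -subr_eq0 -{3}[pairing _ _]mulr1 -mulrBr mulf_eq0.
by rewrite subr_eq0 => /orP [] /eqP; [left|right].
Qed.

Lemma pairing0 phi c : bspan b c = 0 -> pairing phi c = 0.
Proof. by move=> /hb ->; apply: big1 => i _; rewrite ffunE mul0r. Qed.

Lemma frob_coords_inj j (h h' : 'I_d -> F) :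
    (forall l, (l < d)%N -> \sum_i h i * frob (j + l) (b i) = \sum_i h' i * frob (j + l) (b i)) ->
  h =1 h'.
Proof.
move=> e; have e0 : (\row_i h i) - (\row_i h' i) = 0.
  apply: (window_eq0 b_free (j := j)) => l ld.
  rewrite -[- _]scaleN1r -[X in X + _]scale1r ev_comb mul1r mulN1r.
  have hE (g : 'I_d -> F) : ev hF b (\row_i g i) (j + l) = \sum_i g i * frob (j + l) (b i).
    by apply: eq_bigr => i _; rewrite mxE.
  by rewrite !hE e // subrr.
by move=> i; have /rowP/(_ i) := e0; rewrite !mxE => /eqP; rewrite subr_eq0 => /eqP.
Qed.

Definition inv_coord (w : {ffun 'I_d -> bool} -> F) (i : 'I_d) : F :=
  \sum_c w c * (c i)%:R / bspan b c.

Lemma inv_coord_frob w l :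
  \sum_i inv_coord w i * frob l (b i) = \sum_c w c * frob l (bspan b c) / bspan b c.
Proof.
transitivity (\sum_i \sum_c w c * ((c i)%:R * frob l (b i)) / bspan b c).
  by apply: eq_bigr => i _; rewrite mulr_suml; apply: eq_bigr => c _; ring.
rewrite exchange_big; apply: eq_bigr => c _ /=.
by rewrite frob_bspan mulr_sumr mulr_suml.
Qed.

(** Pairing the moments of 1 / x with b_i^(2^l) gives the sum of x^(2^l - 1) over A,
    where 0 is left out when l = 0. *)
Lemma inv_coord_dual : inv_coord (fun=> 1) =1 z.
Proof.
apply: (frob_coords_inj (j := 0)) => l ld; rewrite inv_coord_frob hz //.
case: l ld => [|l] ld.
  transitivity (\sum_(c : {ffun 'I_d -> bool}) 1 - 1 : F).
    rewrite (bigD1 [ffun=> false]) //= [in RHS](bigD1 [ffun=> false]) //= addrAC subrr add0r.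
    rewrite {1}/bspan big1 ?rmorph0 ?mulr0 ?mul0r ?add0r => [|i _]; last by rewrite ffunE mul0r.
    apply: eq_bigr => c nc; rewrite mul1r divff //.
    by apply: contraNneq nc => /hb ->.
  by rewrite (cube_sum1 hF d0) sub0r (oppx hF).
rewrite -[RHS](cube_sum_exp hF b ld); apply: eq_bigr => c _.
by rewrite mul1r frob_div.
Qed.

(** The moments of phi(x) / x are orthogonal to X_0, ..., X_(d-2), and so are the
    square roots of the dual basis; hence they are proportional.  Pairing with phi
    itself, where phi^2 = phi, determines the factor. *)
Lemma pairing_inv_sum phi psi : (1 < d)%N ->
  \sum_c pairing phi c * pairing psi c / bspan b c
  = frob m.-1 (bspan z phi * bspan z psi).
Proof.
move=> d1; have m0 := m_gt0 hF.
pose s i := frob m.-1 (z i).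
have sE l : \sum_i s i * frob (0 + l) (b i) = frob m.-1 (\sum_i z i * frob l.+1 (b i)).
  rewrite rmorph_sum; apply: eq_bigr => i _; rewrite rmorphM /= frob_frob.
  congr (_ * _); rewrite add0n addnS -addSn prednK //.
  by apply: frob_eqm; rewrite modnDl.
have s_nz : \sum_i s i * frob (0 + d.-1) (b i) != 0.
  rewrite sE fmorph_eq0 prednK //; apply/eqP => zd.
  have : z =1 (fun=> 0).
    apply: (frob_coords_inj (j := 1)) => l ld; rewrite [RHS]big1 => [|i _]; last by rewrite mul0r.
    have [ld1|] := ltnP l.+1 d; first by rewrite add1n hz.
    by move=> dl; rewrite -[RHS]zd (_ : 1 + l = d)%N //; lia.
  move=> z0; have := hz d0; rewrite big1 => [/esym/eqP|i _]; last by rewrite z0 mul0r.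
  by rewrite oner_eq0.
pose h := inv_coord (pairing phi).
pose k := (\sum_i h i * frob (0 + d.-1) (b i)) / (\sum_i s i * frob (0 + d.-1) (b i)).
have hk : h =1 (fun i => k * s i).
  apply: (frob_coords_inj (j := 0)) => l ld.
  rewrite [RHS](eq_bigr (fun i => k * (s i * frob (0 + l) (b i)))) => [|i _]; last by rewrite mulrA.
  rewrite -mulr_sumr; have [->|nl] := eqVneq l d.-1; first by rewrite divfK.
  rewrite sE hz; last lia.
  rewrite /= rmorph0 mulr0 inv_coord_frob add0n.
  have small : (1 + l < d)%N by lia.
  rewrite -[RHS](moment_small hF b (fun (_ : 'I_1) i => (phi i)%:R) small).
  apply: eq_bigr => c _; rewrite big_ord1 -/(pairing phi c).
  have [c0|nc] := eqVneq (bspan b c) 0; first by rewrite (pairing0 phi c0) !mul0r.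
  rewrite -mulrA; congr (_ * _); case: (l) => [|l']; last by rewrite frob_div.
  by rewrite frob0 divff // expr0.
have sum_h chi : \sum_c pairing phi c * pairing chi c / bspan b c = k * frob m.-1 (bspan z chi).
  rewrite frob_bspan mulr_sumr (eq_bigr (fun i => (chi i)%:R * h i)) => [|i _]; last first.
    by rewrite hk mulrCA.
  under [RHS]eq_bigr => i _ do rewrite mulr_sumr.
  rewrite exchange_big; apply: eq_bigr => c _ /=.
  by rewrite [pairing chi c]/pairing mulr_sumr mulr_suml; apply: eq_bigr => i _; ring.
rewrite sum_h rmorphM /=; congr (_ * _).
have : k * frob m.-1 (bspan z phi) = bspan z phi.
  rewrite -sum_h; under eq_bigr => c _ do rewrite pairing_sqr.
  rewrite /bspan; under [RHS]eq_bigr => i _ do rewrite -inv_coord_dual mulr_sumr.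
  rewrite exchange_big; apply: eq_bigr => c _ /=.
  by rewrite /pairing mulr_suml; apply: eq_bigr => i _; rewrite /bspan; ring.
have {2}-> : bspan z phi = frob m.-1 (bspan z phi) ^+ 2.
  by rewrite -frobS prednK // frob_m.
have [y0|ny] := eqVneq (frob m.-1 (bspan z phi)) 0; last by rewrite expr2 => /(mulIf ny).
move=> _; rewrite y0.
have phi0 : phi = [ffun=> false].
  apply: (moore_free (det_dual_neq0 hz)).
  by move/eqP: y0; rewrite fmorph_eq0 => /eqP.
rewrite /k big1 ?mul0r // => i _.
by rewrite /h /inv_coord big1 ?mul0r // => c _; rewrite /pairing big1 ?mul0r // => t _; rewrite phi0 ffunE mulr0.
Qed.

End Inverses.

(** * The two leading coefficients *)

Lemma card_le_fibers (T U : finType) (f : T -> U) (D : {set T}) (B : {set U}) k :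
    (forall x, x \in D -> f x \in B) ->
    (forall y, y \in B -> (#|[set x in D | f x == y]| <= k)%N) ->
  (#|D| <= #|B| * k)%N.
Proof.
move=> fB fk; rewrite -sum1_card (partition_big f (mem B)) //= -sum_nat_const.
apply: leq_sum => y By; apply: leq_trans (fk y By).
by rewrite sum1_card; apply: subset_leq_card; apply/subsetP => x; rewrite !inE.
Qed.

(** Coefficients are kept apart so that the lemma can be used as a test of five points
    on two conics, besides bounding fibers. *)
Lemma quartic_eq0 (F : finFieldType) (c0 c1 c2 c3 c4 : F) (S : {set F}) :
    (forall x, x \in S -> c0 + c1 * x + c2 * x ^+ 2 + c3 * x ^+ 3 + c4 * x ^+ 4 = 0) ->
    (4 < #|S|)%N ->
  [/\ c0 = 0, c1 = 0, c2 = 0, c3 = 0 & c4 = 0].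
Proof.
move=> hS cS; pose p := Poly [:: c0; c1; c2; c3; c4].
suff p0 : p = 0.
  have h i : [:: c0; c1; c2; c3; c4]`_i = 0 by rewrite -coef_Poly -/p p0 coef0.
  by split; [exact: (h 0%N)|exact: (h 1%N)|exact: (h 2%N)|exact: (h 3%N)|exact: (h 4%N)].
apply/eqP; apply: contraLR cS => np; rewrite -leqNgt.
have := max_poly_roots (rs := enum S) np; rewrite enum_uniq -cardE.
have -> : all (root p) (enum S).
  apply/allP => x; rewrite mem_enum => /hS e; rewrite rootE horner_Poly /=.
  by apply/eqP; rewrite -[RHS]e; ring.
move=> /(_ isT isT) h; rewrite -ltnS; apply: leq_trans h _.
exact: (size_Poly [:: c0; c1; c2; c3; c4]).
Qed.

Section Main.
Variables (F : finFieldType) (m : nat).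
Hypothesis hF : #|F| = (2 ^ m)%N.
Local Notation frob := (frobenius (pchar2 hF)).
Local Notation sqrt := (frob m.-1).

Lemma sqrtK x : sqrt x ^+ 2 = x.
Proof. by rewrite -frobS prednK ?(m_gt0 hF) // frob_m. Qed.

(** Tr(mu(y) z) is the given form, so mu maps E to its orthogonal space.  The squared
    equation mu(y) = w is a quartic in y, so unless G = H = 0 its fibers have at
    most 4 elements and #|E| <= 4 #|perp E|. *)
Lemma isotropic_bound (E : {set F}) d (G H : F) :
    zmod_closed E -> #|E| = (2 ^ d)%N -> (m + 3 <= d.*2)%N ->
    (forall y z, y \in E -> z \in E ->
       Tr (G * (y * z) + H * (y ^+ 2 * z + y * z ^+ 2)) = 0) ->
  G = 0 /\ H = 0.
Proof.
move=> hE cE hd iso.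
pose mu y := G * y + H * y ^+ 2 + sqrt (H * y).
have mu_perp y : y \in E -> mu y \in perp E.
  move=> Ey; apply/perpP => z Ez; rewrite -[RHS](iso y z Ey Ez) /mu !mulrDl !(TrD hF).
  rewrite -[Tr (sqrt _ * z)](Tr_sqr hF) exprMn sqrtK mulrDr (TrD hF) !mulrA -addrA.
  by congr (_ + (_ + Tr _)); ring.
have [/existsP [w hw]|] := boolP [exists w, (4 < #|[set y in E | mu y == w]|)%N].
  have := @quartic_eq0 F (w ^+ 2) H (G ^+ 2) 0 (H ^+ 2) _ _ hw.
  case=> [y|_ H0 G0 _ _].
    rewrite inE => /andP [_ /eqP <-]; rewrite /mu.
    have -> : (G * y + H * y ^+ 2 + sqrt (H * y)) ^+ 2
        = (G * y + H * y ^+ 2) ^+ 2 + sqrt (H * y) ^+ 2 + 2 * ((G * y + H * y ^+ 2) * sqrt (H * y)) by ring.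
    rewrite sqrtK (two0 hF) mul0r addr0.
    have -> : (G * y + H * y ^+ 2) ^+ 2 + H * y + H * y + G ^+ 2 * y ^+ 2 + 0 * y ^+ 3 + H ^+ 2 * y ^+ 4
       = 2 * (H * y + G ^+ 2 * y ^+ 2 + H ^+ 2 * y ^+ 4 + G * H * y ^+ 3) by ring.
    by rewrite (two0 hF) mul0r.
  by split=> //; move/eqP: G0; rewrite expf_eq0 => /eqP.
rewrite negb_exists => /forallP small.
have : (#|E| <= #|perp E| * 4)%N.
  by apply: (card_le_fibers mu_perp) => w _; rewrite leqNgt.
have := card_perp hF hE; rewrite cE => pE.
have d0 : (0 < 2 ^ d)%N by rewrite expn_gt0.
rewrite -(leq_pmul2l d0) mulnA pE -(expnD 2 m 2) -expnD leq_exp2l //.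
by rewrite addnn; lia.
Qed.

Lemma det_moore2 (y : 'I_2 -> F) :
  \det (moore hF 2 y 0) = y 0 ^+ 2 * y 1 + y 0 * y 1 ^+ 2.
Proof.
rewrite (expand_det_row _ 0) !big_ord_recl big_ord0 /cofactor !det_mx11 !mxE /=.
rewrite /frobenius expn0 expn1 !expr1 !addn0.
rewrite (_ : lift 0 0 = 1 :> 'I_2); last exact: val_inj.
by rewrite expr0 (oppx hF); ring.
Qed.


(** In the moments of Tr p against two functionals phi and psi on A, all monomials of
    index below d - 2 vanish by degree.  What remains is Tr(e / x) and the
    monomial of index d - 2, whose moment is computed by [dual_minor]. *)
Lemma top_two_vanish (A : {set F}) n (al : nat -> F) :
    zmod_closed A -> #|A| = (2 ^ (2 + n))%N -> (m + 3 <= (2 + n).*2)%N -> (0 < n)%N ->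
    (forall x, x \in A -> x != 0 ->
      Tr (\sum_(l < 2 + n) al l * x ^+ (2 ^ l - 1)) = 1) ->
  al n.+1 = 0 /\ al n = 0.
Proof.
move=> hA cA hd n0 hTr; set d := (2 + n)%N in cA hd hTr.
have m0 := m_gt0 hF.
have [b [bA hb]] := zmod_closed_basis hF hA cA.
have fb := free_det_moore hF hb.
have [z hz] := dual_basis_exists fb.
have fz := det_dual_neq0 hz.
(* x^(2^(d-1)) in the basis given by the window at m - 1, whose first column is that
   of the square root *)
pose v : 'cV[F]_d := \col_i (al n.+1 * frob n.+1 (b i)).
pose th := invmx (moore hF d b m.-1) *m v.
have thE i : al n.+1 * frob n.+1 (b i) = \sum_c th c 0 * frob (m.-1 + c) (b i).
  have : v i 0 = (moore hF d b m.-1 *m th) i 0 by rewrite mulKVmx ?moore_unit.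
  by rewrite !mxE => ->; apply: eq_bigr => c _; rewrite !mxE mulrC.
pose t0 := th 0 0.
pose t (l : nat) := th (inord l.+1 : 'I_n.+2) 0.
have frob_shift l x : frob (m.-1 + l.+1) x = frob l x.
  by rewrite addnS -addSn prednK //; apply: frob_eqm; rewrite modnDl.
have thE' i : al n.+1 * frob n.+1 (b i)
    = t0 * sqrt (b i) + \sum_(l < n.+1) t l * frob l (b i).
  rewrite thE big_ord_recl /= addn0; congr (_ + _); apply: eq_bigr => l _.
  rewrite -(frob_shift l); congr (th _ _ * _); apply: val_inj.
  by rewrite /= inordK //; have := ltn_ord l; lia.
have thS c : al n.+1 * frob n.+1 (bspan b c)
    = t0 * sqrt (bspan b c) + \sum_(l < n.+1) t l * frob l (bspan b c).
  have -> : \sum_(l < n.+1) t l * frob l (bspan b c)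
      = \sum_(l < n.+1) \sum_i t l * ((c i)%:R * frob l (b i)).
    by apply: eq_bigr => l _; rewrite frob_bspan mulr_sumr.
  rewrite !frob_bspan !mulr_sumr.
  transitivity (\sum_i (c i)%:R * (al n.+1 * frob n.+1 (b i))).
    by apply: eq_bigr => i _; ring.
  rewrite [in RHS]exchange_big -big_split /=; apply: eq_bigr => i _.
  rewrite thE' mulrDr mulr_sumr; congr (_ + _); first by ring.
  by apply: eq_bigr => l _; ring.
pose be (l : nat) := al l + t l.
pose e := t0 ^+ 2.
have polyE c : bspan b c != 0 ->
    Tr (e / bspan b c) + Tr (\sum_(l < n.+1) be l * bspan b c ^+ (2 ^ l - 1)) = 1.
  move=> nx; rewrite -[RHS](hTr _ (bspan_in hF c hA bA) nx).
  rewrite [in RHS]big_ord_recr /=.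
  have -> : al n.+1 * bspan b c ^+ (2 ^ n.+1 - 1)
     = t0 * sqrt (bspan b c) / bspan b c + \sum_(l < n.+1) t l * bspan b c ^+ (2 ^ l - 1).
    rewrite -(frob_div hF) // mulrA thS mulrDl mulr_suml; congr (_ + _).
    apply: eq_bigr => l _; rewrite -mulrA; congr (_ * _).
    by case: l => -[|l] ?; [rewrite frob0 divff // expr0|rewrite frob_div].
  rewrite addrCA (TrD hF); congr (_ + Tr _).
    by rewrite -[RHS](Tr_sqr hF) exprMn exprMn sqrtK /e; congr Tr; field.
  by rewrite -big_split; apply: eq_bigr => l _; rewrite mulrDl.
pose E := [set bspan z c | c : {ffun 'I_d -> bool}].
have hE : zmod_closed E.
  split=> [|x y /imsetP [c _ ->] /imsetP [c' _ ->]].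
    by apply/imsetP; exists [ffun=> false]; rewrite // /bspan big1 // => i _; rewrite ffunE mul0r.
  by rewrite (oppx hF) (bspan_xor hF); apply: imset_f.
have cE : #|E| = (2 ^ d)%N.
  rewrite card_imset ?card_cube //; apply: (bspan_inj hF) => c.
  exact: (moore_free fz).
pose bn := be n.
pose W (phi psi : {ffun 'I_d -> bool}) (s : 'I_2) (i : 'I_d) : F :=
  if s == 0 then (phi i)%:R else (psi i)%:R.
have key phi psi : Tr (e * sqrt (bspan z phi * bspan z psi) + bn *
    moment b (W phi psi) n) = 0.
  set V := W phi psi.
  have VE (c : {ffun 'I_d -> bool}) : \prod_(s < 2) \sum_i (c i)%:R * V s i = pairing F phi c * pairing F psi c.
    by rewrite big_ord_recr big_ord1 /=.
  have small : (2 + 0 < d)%N by lia.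
  rewrite -[RHS](moment_small hF b V small).
  transitivity (\sum_(c : {ffun 'I_d -> bool}) (\prod_(s < 2) \sum_i (c i)%:R * V s i) *
      (Tr (e / bspan b c) + Tr (\sum_(l < n.+1) be l * bspan b c ^+ (2 ^ l - 1)))); last first.
    apply: eq_bigr => c _; rewrite expr0 mulr1 VE.
    have [c0|nc] := eqVneq (bspan b c) 0; last by rewrite polyE // mulr1.
    by rewrite (pairing0 hb phi c0) !mul0r.
  have TrM (w y : F) : w = 0 \/ w = 1 -> w * Tr y = Tr (w * y).
    by case=> ->; rewrite ?mul0r ?(Tr0 hF) ?mul1r.
  have w01 c : pairing F phi c * pairing F psi c = 0 \/ pairing F phi c * pairing F psi c = 1.
    by case: (pairing01 hF phi c) => ->; rewrite ?mul0r ?mul1r; [left|exact: (pairing01 hF)].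
  transitivity (\sum_(c : {ffun 'I_d -> bool}) Tr (pairing F phi c * pairing F psi c *
      (e / bspan b c + (\sum_(l < n.+1) be l * bspan b c ^+ (2 ^ l - 1))))); last first.
    by apply: eq_bigr => c _; rewrite VE -TrM // (TrD hF).
  rewrite -(Tr_sum hF); congr Tr.
  under [RHS]eq_bigr => c _ do rewrite mulrDr.
  rewrite big_split /=; congr (_ + _).
    rewrite -(pairing_inv_sum _ hb hz) ?mulr_sumr //.
    by apply: eq_bigr => c _; ring.
  under [RHS]eq_bigr => c _ do rewrite mulr_sumr.
  rewrite exchange_big big_ord_recr /= big1 ?add0r => [|l _].
    by rewrite /moment mulr_sumr; apply: eq_bigr => c _; rewrite VE mulrCA.
  have small' : (2 + l < d)%N by have := ltn_ord l; lia.
  transitivity (be l * moment b V l).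
    by rewrite /moment mulr_sumr; apply: eq_bigr => c _; rewrite VE mulrCA.
  by rewrite (moment_small hF) ?mulr0.
pose D := \det (moore hF d b 0).
have mom4 phi psi : frob 2 (moment b (W phi psi) n) =
    D * (bspan z phi ^+ 2 * bspan z psi + bspan z phi * bspan z psi ^+ 2).
  rewrite (moment_det hF (n := 2)).
  have := dual_minor (fun s : 'I_2 => if s == 0 then phi else psi) hz.
  rewrite det_moore2 /= => <-; congr (frob 2 (\det (row_mx _ _))).
  by apply/matrixP => i s; rewrite !mxE /W; case: (s == 0).
have [eG bH] : e ^+ 2 = 0 /\ bn ^+ 4 * D = 0.
  apply: (isotropic_bound hE cE hd) => _ _ /imsetP [phi _ ->] /imsetP [psi _ ->].
  have := key phi psi; rewrite -(Tr_frob hF 2) rmorphD /= !rmorphM /= mom4.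
  rewrite !(TrD hF) => <-; congr (_ + Tr _); last by rewrite [RHS]mulrA.
  have fs y : frob 2 (sqrt y) = y ^+ 2 by rewrite frobSl sqrtK.
  by rewrite -[LHS](Tr_sqr hF) !fs /e /frobenius; congr Tr; ring.
have e0 : t0 = 0 by apply/eqP; move/eqP: eG; rewrite /e -exprM expf_eq0.
have bn0 : bn = 0.
  by apply/eqP; move/eqP: bH; rewrite mulf_eq0 (negbTE fb) orbF expf_eq0.
pose w : 'cV[F]_n.+2 := \col_l (if l == ord_max then al n.+1 else t l).
have w0 : moore hF d b 0 *m w = 0.
  apply/colP => i; rewrite !mxE big_ord_recr /= !mxE eqxx.
  rewrite [frob _ _ * _]mulrC thE' e0 mul0r add0r -[RHS](addxx hF (\sum_(l < n.+1) t l * frob l (b i))).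
  congr (_ + _); apply: eq_bigr => l _; rewrite !mxE mulrC.
  by rewrite (_ : (_ == _) = false) //; apply/negP => /eqP /(congr1 val) /=; have := ltn_ord l; lia.
have {}w0 : w = 0 by rewrite -[w](mulKmx (moore_unit fb 0)) w0 mulmx0.
have al1 : al n.+1 = 0 by have /colP/(_ ord_max) := w0; rewrite !mxE eqxx.
split=> //; have /colP/(_ (inord n)) := w0; rewrite !mxE inordK; last lia.
rewrite (_ : (_ == _) = false) => [tn|].
  by move: bn0; rewrite /bn /be tn addr0.
by apply/negP => /eqP /(congr1 val) /=; rewrite inordK; lia.
Qed.

End Main.

(** * Maps of trace one on a large subgroup are affine *)

Section Linear.
Variables (F : finFieldType) (m : nat).
Hypothesis hF : #|F| = (2 ^ m)%N.

(** Descending induction on l: the coefficients above l vanish already, so l is the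
    leading index. *)
Theorem trace_one_poly_affine (A : {set F}) d (al : nat -> F) :
    zmod_closed A -> #|A| = (2 ^ d)%N -> (m + 3 <= d.*2)%N -> m != 9%N ->
    (forall x, x \in A -> x != 0 -> Tr (\sum_(l < d) al l * x ^+ (2 ^ l - 1)) = 1) ->
  forall l, (2 <= l)%N -> (l < d)%N -> al l = 0.
Proof.
move=> hA cA hd m9 hTr.
have dm : (d <= m)%N.
  by rewrite -(@leq_exp2l 2) // -cA -hF max_card.
suff h k l : (2 <= l)%N -> (l < d)%N -> (d <= l + k)%N -> al l = 0.
  by move=> l l2 ld; apply: (h d) => //; lia.
elim: k l => [|k IH] l l2 ld lk; first lia.
have top l' : (l < l' < d)%N -> al l' = 0 by move=> hl; apply: IH; lia.
have [dl|dl] := ltnP l.+2 d; last first.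
  have [n dn] : exists n, d = (2 + n)%N by exists (d - 2)%N; lia.
  rewrite dn in cA hd hTr; have n0 : (0 < n)%N by lia.
  have [a1 a0] := top_two_vanish hF hA cA hd n0 hTr.
  by have [->|->] : l = n.+1 \/ l = n by lia.
apply/eqP; apply: contraT => na; exfalso.
have cA' : #|A| = (2 ^ (d - l + l))%N by rewrite subnK // ltnW.
have [b [bA hb]] := zmod_closed_basis hF hA cA'.
apply: (moore_form_not_isotropic (free_det_moore hF hb) na) => //; try lia.
move=> u hu; apply: (top_moore_trace hF hA cA hTr) => //; first lia.
by move=> i; have [c ->] := hu i; apply: (bspan_in hF).
Qed.

End Linear.

(** * Affine points of the plane *)

Section Points.
Variable F : finFieldType.
Implicit Types (v w : 'rV[F]_3) (u : F * F).

Lemma vec3E (x y z : F) :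
  [/\ vec3 x y z 0 0 = x, vec3 x y z 0 1 = y & vec3 x y z 0 2 = z].
Proof. by rewrite !mxE. Qed.

Lemma vec3_eta v : v = vec3 (v 0 0) (v 0 1) (v 0 2).
Proof.
apply/rowP => -[[|[|[|//]]] h]; rewrite mxE /=; congr (v _ _); exact: val_inj.
Qed.

Lemma vec3_inj (x y z x' y' z' : F) :
  vec3 x y z = vec3 x' y' z' -> [/\ x = x', y = y' & z = z'].
Proof.
move/rowP=> e; split.
- by have := e 0; rewrite !mxE.
- by have := e 1; rewrite !mxE.
- by have := e 2; rewrite !mxE.
Qed.

Lemma scale_vec3 k (x y z : F) : k *: vec3 x y z = vec3 (k * x) (k * y) (k * z).
Proof. by apply/rowP => -[[|[|[|//]]] h]; rewrite !mxE. Qed.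

Lemma vec3_eq0 (x y z : F) : (vec3 x y z == 0) = [&& x == 0, y == 0 & z == 0].
Proof.
have -> : 0 = vec3 0 0 0 :> 'rV[F]_3 by apply/rowP => -[[|[|[|//]]] h]; rewrite !mxE.
apply/eqP/and3P => [/vec3_inj [-> -> ->]|[/eqP -> /eqP -> /eqP ->]] //.
Qed.

Lemma mem_pt v : v \in pt v.
Proof. by apply/imsetP; exists 1; rewrite ?scale1r. Qed.

Lemma pt_scale k v : k != 0 -> pt (k *: v) = pt v.
Proof.
move=> nk; apply/setP => w; apply/imsetP/imsetP => -[a _ ->].
  by exists (a * k); rewrite ?scalerA.
by exists (a / k); rewrite // scalerA divfK.
Qed.

Lemma pt_eqP v w : v != 0 -> pt v = pt w -> exists2 k, k != 0 & v = k *: w.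
Proof.
move=> nv e; have : v \in pt w by rewrite -e mem_pt.
case/imsetP => k _ vk; exists k => //.
by apply: contraNneq nv => k0; rewrite vk k0 scale0r.
Qed.

Definition aff u : {set 'rV[F]_3} := pt (vec3 u.1 u.2 1).

Lemma aff_inj : injective aff.
Proof.
move=> [x y] [x' y'] /pt_eqP []; first by rewrite vec3_eq0 oner_eq0 !andbF.
move=> k _; rewrite scale_vec3 => /vec3_inj [/= -> -> ]; rewrite mulr1 => <-.
by rewrite !mul1r.
Qed.

Lemma pt_vec3 (x y z : F) : z != 0 -> pt (vec3 x y z) = aff (x / z, y / z).
Proof.
move=> nz; rewrite -(pt_scale _ (invr_neq0 nz)) scale_vec3 mulVf //.
by rewrite ![z^-1 * _]mulrC.
Qed.

Lemma aff_PG2 u : aff u \in PG2 F.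
Proof. by apply: imset_f; rewrite inE vec3_eq0 oner_eq0 !andbF. Qed.

(** The vectors representing three points of a two-dimensional space are linearly
    dependent. *)
Lemma collinear_aff (S : {set F * F}) u1 u2 u : collinear (aff @: S) ->
  u1 \in S -> u2 \in S -> u \in S -> u1 != u2 ->
  (u1.2 - u2.2) * u.1 + (u2.1 - u1.1) * u.2 + (u1.1 * u2.2 - u2.1 * u1.2) = 0.
Proof.
move=> [U [dU hU]] S1 S2 S0 n12.
have inU (w : F * F) : w \in S -> vec3 w.1 w.2 1 \in U.
  by move=> Sw; apply: (hU (aff w) (imset_f aff Sw)); apply: mem_pt.
pose X := [:: vec3 u1.1 u1.2 1; vec3 u2.1 u2.2 1; vec3 u.1 u.2 1].
have : ~~ free X.
  apply/negP => fX; have : (\dim <<X>> <= 2)%N.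
    apply: leq_trans (_ : \dim U <= 2)%N; last by rewrite dU.
    apply: dimvS; apply/span_subvP => w.
    by rewrite !inE => /or3P [] /eqP ->; apply: inU.
  by rewrite (eqnP fX).
move/freeP => nf.
have [k hk [i ki]] : exists2 k : 'I_3 -> F, \sum_i k i *: X`_i = 0 & exists i, k i != 0.
  have /existsP [k /andP [/eqP h /existsP hi]] : [exists k : {ffun 'I_3 -> F},
     (\sum_i k i *: X`_i == 0) && [exists i, k i != 0]].
    apply: contraT; rewrite negb_exists => /forallP h; case: nf => k hk i.
    have := h (finfun k); rewrite negb_and => /orP [].
      by rewrite (eq_bigr (fun i : 'I_3 => k i *: X`_i)) ?hk ?eqxx // => j _; rewrite ffunE.
    by rewrite negb_exists => /forallP /(_ i); rewrite ffunE negbK => /eqP.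
  by exists k.
move: hk ki; rewrite !big_ord_recl big_ord0 addr0 /= !scale_vec3.
set k0 := k _; set k1 := k _; set k2 := k _ => hk ki.
have /rowP h := hk; have := (h 0, h 1, h 2); rewrite !mxE /= !mulr1 => -[[hx hy] hz].
have k0E : k0 = - k1 - k2 by apply/eqP; rewrite -subr_eq0 -hz; apply/eqP; ring.
have nk2 : k2 != 0.
  apply/negP => /eqP k20; move: hx hy; rewrite k0E k20 !subr0 !mul0r !addr0 => hx hy.
  have nk1 : k1 != 0.
    apply: contraNneq ki => k10; case: i => -[|[|[|//]]] hi.
    - rewrite (_ : k _ = k0); last by rewrite /k0; congr (k _); apply: val_inj.
      by rewrite k0E k10 k20 !oppr0 addr0.
    - rewrite (_ : k _ = k1); last by rewrite /k1; congr (k _); apply: val_inj.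
      by rewrite k10.
    - rewrite (_ : k _ = k2); last by rewrite /k2; congr (k _); apply: val_inj.
      by rewrite k20.
  case/eqP: n12; rewrite [u1]surjective_pairing [u2]surjective_pairing.
  congr pair; apply: (mulfI nk1); apply/eqP; rewrite eq_sym -subr_eq0.
    by rewrite -hx; apply/eqP; ring.
  by rewrite -hy; apply/eqP; ring.
apply: (mulfI nk2); rewrite mulr0.
have -> : k2 * ((u1.2 - u2.2) * u.1 + (u2.1 - u1.1) * u.2 + (u1.1 * u2.2 - u2.1 * u1.2))
  = (u1.2 - u2.2) * (k2 * u.1) + (u2.1 - u1.1) * (k2 * u.2) + k2 * (u1.1 * u2.2 - u2.1 * u1.2) by ring.
have -> : k2 * u.1 = - (k0 * u1.1 + k1 * u2.1) by apply/eqP; rewrite -subr_eq0 -hx; apply/eqP; ring.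
have -> : k2 * u.2 = - (k0 * u1.2 + k1 * u2.2) by apply/eqP; rewrite -subr_eq0 -hy; apply/eqP; ring.
by rewrite k0E; ring.
Qed.

End Points.
Arguments aff {F} u.

(** * The conics of the arc *)

Section Arc.
Variables (F : finFieldType) (m : nat).
Hypothesis hF : #|F| = (2 ^ m)%N.
Local Notation frob := (frobenius (pchar2 hF)).
Local Notation sqrt := (frob m.-1).

Lemma sqr_inj (x y : F) : x ^+ 2 = y ^+ 2 -> x = y.
Proof. exact: (@fmorph_inj _ _ (frob 1)). Qed.

Lemma sqrD2 (x y : F) : (x + y) ^+ 2 = x ^+ 2 + y ^+ 2.
Proof. exact: (rmorphD (frob 1)). Qed.

Lemma Tr_artin_schreier (t : F) : Tr (t ^+ 2 + t) = 0.
Proof. by rewrite (TrD hF) (Tr_sqr hF) (addxx hF). Qed.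

Lemma Tr_quadratic_root (a h b t : F) : h != 0 -> a + h * t + b * t ^+ 2 = 0 -> Tr (a * b / h ^+ 2) = 0.
Proof.
move=> nh e; rewrite -(Tr_artin_schreier (b * t / h)); congr Tr.
have -> : a = h * t + b * t ^+ 2.
  by apply/eqP; rewrite -(addr_eq0_2 hF) addrA; apply/eqP.
by field.
Qed.

(** The form is irreducible, so the conics of the arc miss the line z = 0 and the
    plane may be treated as affine. *)
Lemma form_anisotropic (al x y : F) : Tr al = 1 -> al * x ^+ 2 + x * y + y ^+ 2 = 0 -> x = 0 /\ y = 0.
Proof.
move=> ha e; have [x0|nx] := eqVneq x 0.
  by move: e; rewrite x0 expr0n mulr0 mul0r !add0r => /eqP; rewrite expf_eq0 => /eqP.
have e' : al + 1 * (y / x) + 1 * (y / x) ^+ 2 = 0.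
  rewrite -[RHS](mul0r (x ^+ 2)^-1) -e; field; exact: nx.
have := Tr_quadratic_root (oner_neq0 F) e'.
by rewrite expr1n mulr1 divr1 ha => /eqP; rewrite oner_eq0.
Qed.

Definition form (al : F) (u : F * F) : F := al * u.1 ^+ 2 + u.1 * u.2 + u.2 ^+ 2.

Lemma conic_affine (al la : F) : Tr al = 1 -> la != 0 ->
  conic al 1 la = [set aff u | u in [set u | (form al u == la) && (u != (0, 0))]].
Proof.
move=> ha nla; apply/setP => P; apply/imsetP/imsetP => -[].
  move=> v; rewrite inE /= mul1r => /andP [nv /eqP hv] ->.
  have nz : v 0 2 != 0.
    apply: contraNneq nv => z0; move: hv; rewrite z0 expr0n mulr0 addr0.
    by case/(form_anisotropic ha) => x0 y0; rewrite [v]vec3_eta x0 y0 z0 vec3_eq0 eqxx.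
  exists (v 0 0 / v 0 2, v 0 1 / v 0 2); last by rewrite [in LHS](vec3_eta v) pt_vec3.
  move: hv nv nz; move: (v 0 2) (v 0 0) (v 0 1) => z x y hv nv nz.
  have hz : al * x ^+ 2 + x * y + y ^+ 2 = la * z ^+ 2.
    by apply/eqP; rewrite -(addr_eq0_2 hF) hv.
  have fE : form al (x / z, y / z) = la.
    have -> : la = la * z ^+ 2 / z ^+ 2 by rewrite mulfK // expf_neq0.
    by rewrite -hz /form /=; field.
  rewrite inE fE eqxx; apply: contraNneq nla => -[x0 y0].
  by rewrite -fE x0 y0 /form /= expr0n mulr0 mul0r !addr0.
move=> u; rewrite inE => /andP [/eqP hu nu] ->; exists (vec3 u.1 u.2 1) => //.
rewrite inE vec3_eq0 oner_eq0 !andbF /=; have [-> -> ->] := vec3E u.1 u.2 1.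
by rewrite mul1r expr1n mulr1 -hu (addxx hF).
Qed.

Variables (A : {set F}) (d : nat) (p : {poly F}).
Hypotheses (hA : zmod_closed A) (cA : #|A| = (2 ^ d)%N).
Hypothesis hTr : forall la, la \in A -> la != 0 -> Tr p.[la] = 1.
Hypothesis hL : forall x y : F, (x + y) * p.[x + y] = x * p.[x] + y * p.[y].

Definition arc_aff : {set F * F} :=
  [set u | (u == (0, 0)) || [exists la in A, (la != 0) && (form p.[la] u == la)]].

Lemma arc_affP u : reflect (u = (0, 0) \/ exists la, [/\ la \in A, la != 0 & form p.[la] u = la])
  (u \in arc_aff).
Proof.
rewrite inE; apply: (iffP orP) => -[/eqP|]; try by [left|left; apply/eqP].
  by case/exists_inP => la Ala /andP [nla /eqP h]; right; exists la.
by case=> la [Ala nla h]; right; apply/exists_inP; exists la; rewrite ?nla ?h ?eqxx.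
Qed.

Lemma form00 al : form al (0, 0) = 0.
Proof. by rewrite /form /= expr0n mulr0 mul0r !addr0. Qed.

Lemma pq_arc_affine : pq_arc p 1 A = aff @: arc_aff.
Proof.
apply/setP => P; rewrite !inE; apply/orP/imsetP.
  case=> [/eqP ->|/bigcupP [la]].
    by exists (0, 0) => //; apply/arc_affP; left.
  rewrite !inE => /andP [nla Ala]; rewrite hornerC conic_affine ?hTr // => /imsetP [u].
  rewrite inE => /andP [/eqP hu _] ->; exists u => //; apply/arc_affP; right.
  by exists la.
case=> u /arc_affP [->|[la [Ala nla hu]]] ->; first by left.
right; apply/bigcupP; exists la; first by rewrite !inE nla.
rewrite hornerC conic_affine ?hTr //; apply: imset_f; rewrite inE hu eqxx /=.
by apply: contraNneq nla => u0; rewrite -hu u0 form00.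
Qed.

(** Dividing the equation of the conic by x^2 makes la / x^2 + al of the form t^2 + t. *)
Lemma Tr_on_conic al la x y : x != 0 -> form al (x, y) = la -> Tr (la / x ^+ 2) = Tr al.
Proof.
move=> nx e; have e' : (al + la / x ^+ 2) + 1 * (y / x) + 1 * (y / x) ^+ 2 = 0.
  have -> : la / x ^+ 2 = al + y / x + (y / x) ^+ 2 by rewrite -e /form /=; field.
  rewrite !mul1r -[RHS](mul0r (al + y / x + (y / x) ^+ 2)) -(two0 hF); ring.
have := Tr_quadratic_root (oner_neq0 F) e'.
by rewrite expr1n mulr1 divr1 (TrD hF) => /eqP; rewrite (addr_eq0_2 hF) => /eqP.
Qed.

(** The conics with parameters la and la' at a common point force the one with
    parameter la + la' through it, as x p(x) is additive.  But then Tr(la / x^2) would be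
    additive in la and equal to 1 at all three. *)
Lemma param_unique u la la' : la \in A -> la != 0 -> la' \in A -> la' != 0 ->
  form p.[la] u = la -> form p.[la'] u = la' -> la = la'.
Proof.
case: u => x y; move=> Al nl Al' nl' e e'; apply/eqP; apply: contraT => ne.
have [x0|nx] := eqVneq x 0.
  by case/eqP: ne; rewrite -e -e' /form x0 /= expr0n !mulr0 !mul0r !add0r.
have n3 : la + la' != 0 by rewrite (addr_eq0_2 hF).
have A3 : la + la' \in A by apply: (zmod_closed_add hF).
have e3 : form p.[la + la'] (x, y) = la + la'.
  apply: (mulfI n3).
  transitivity ((la + la') * p.[la + la'] * x ^+ 2 + (la + la') * (x * y + y ^+ 2)).
    by rewrite /form /=; ring.
  rewrite hL -expr2 sqrD2.
  transitivity (la * form p.[la] (x, y) + la' * form p.[la'] (x, y)).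
    by rewrite /form /=; ring.
  by rewrite e e' !expr2.
have := Tr_on_conic nx e3; rewrite mulrDl (TrD hF) (Tr_on_conic nx e) (Tr_on_conic nx e').
by rewrite !hTr // (addxx hF) => /esym/eqP; rewrite oner_eq0.
Qed.

End Arc.

(** * The arc is maximal *)

Section MaximalArc.
Variables (F : finFieldType) (m : nat).
Hypothesis hF : #|F| = (2 ^ m)%N.
Local Notation frob := (frobenius (pchar2 hF)).
Local Notation sqrt := (frob m.-1).
Variables (A : {set F}) (d : nat) (p : {poly F}).
Hypotheses (hA : zmod_closed A) (cA : #|A| = (2 ^ d)%N).
Hypothesis hTr : forall la, la \in A -> la != 0 -> Tr p.[la] = 1.
Hypothesis hL : forall x y : F, (x + y) * p.[x + y] = x * p.[x] + y * p.[y].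
Local Notation arc := (arc_aff A p).

Lemma form_dir_neq0 (al t : F) : Tr al = 1 -> al + t + t ^+ 2 != 0.
Proof.
move=> ha; apply/eqP => e; have [] := form_anisotropic hF ha (x := 1) (y := t).
  by rewrite -e; ring.
by move/eqP; rewrite oner_eq0.
Qed.

(** One point of each conic in each direction from the nucleus; None is the
    vertical direction. *)
Definition arc_param (x : F * option F) : F * F :=
  match x.2 with
  | Some t => let s := sqrt (x.1 / (p.[x.1] + t + t ^+ 2)) in (s, s * t)
  | None => (0, sqrt x.1)
  end.

Lemma form_arc_param (la : F) o : Tr p.[la] = 1 -> form p.[la] (arc_param (la, o)) = la.
Proof.
move=> ha; case: o => [t|]; rewrite /arc_param /form /=.
  rewrite exprMn sqrtK; have := form_dir_neq0 t ha; set D := _ + _ => nD.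
  set s := sqrt _; have -> : p.[la] * (la / D) + s * (s * t) + la / D * t ^+ 2 =
    p.[la] * (la / D) + s ^+ 2 * t + la / D * t ^+ 2 by ring.
  by rewrite sqrtK -[RHS](divfK nD) /D; ring.
by rewrite sqrtK expr0n mulr0 mul0r !add0r.
Qed.

Lemma arc_param_fst (la t : F) : Tr p.[la] = 1 -> la != 0 -> (arc_param (la, Some t)).1 != 0.
Proof. by move=> ha nla; rewrite /= fmorph_eq0 mulf_neq0 ?invr_eq0 ?form_dir_neq0. Qed.

Lemma arc_aff_param : arc = (0, 0) |: [set arc_param x | x in setX (A :\ 0) [set: option F]].
Proof.
apply/setP => u; rewrite in_setU1; apply/arc_affP/orP => [[->|[la [Ala nla hu]]]|].
- by left.
- right; apply/imsetP; case: u hu => x y hu; have ha := hTr Ala nla.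
  have [x0|nx] := eqVneq x 0.
    exists (la, None); first by rewrite !inE nla Ala.
    rewrite /arc_param /= x0; congr (_, _); apply: (sqr_inj hF); rewrite sqrtK -hu /form x0 /=.
    by rewrite expr0n mulr0 mul0r !add0r.
  exists (la, Some (y / x)); first by rewrite !inE nla Ala.
  rewrite /arc_param /=; set s := sqrt _.
  have -> : s = x; last by congr (_, _); field.
  apply: (sqr_inj hF); rewrite sqrtK; apply: (mulIf (form_dir_neq0 (y / x) ha)).
  by rewrite divfK ?form_dir_neq0 // -[LHS]hu /form /=; field.
case=> [/eqP ->|/imsetP [[la o]]]; first by left.
rewrite !inE /= andbT => /andP [nla Ala] ->; right; exists la; split=> //.
by apply: form_arc_param; apply: hTr.
Qed.

Lemma card_arc_aff : #|arc| = (#|F| * (2 ^ d - 1) + 2 ^ d)%N.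
Proof.
have hS (x : F * option F) : x \in setX (A :\ 0) [set: option F] -> x.1 \in A /\ x.1 != 0.
  by rewrite !inE andbT => /andP [].
rewrite arc_aff_param cardsU1 card_in_imset.
  have cA0 : (#|A :\ 0%R|.+1 = 2 ^ d)%N by rewrite -cA [RHS](cardsD1 0%R) (zmod_closed_0 hA).
  rewrite cardsX cardsT card_option.
  have -> : (0, 0) \notin [set arc_param x | x in setX (A :\ 0) [set: option F]].
    apply/negP => /imsetP [[la o] /hS [Ala nla] e].
    have := form_arc_param o (hTr Ala nla); rewrite -e form00 => /esym/eqP.
    by rewrite (negbTE nla).
  rewrite -cA0 subn1 /=; lia.
move=> [la o] [la' o'] /hS [/= Ala nla] /hS [/= Ala' nla'] e.
have el : la = la'.
  apply: (param_unique hF hA hTr hL Ala nla Ala' nla' (u := arc_param (la, o))).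
    exact: form_arc_param (hTr Ala nla).
  by rewrite e; apply: form_arc_param (hTr Ala' nla').
move: e; rewrite -el => {la' el Ala' nla'} e; congr (_, _).
have f1 t := arc_param_fst t (hTr Ala nla).
move: e; case: o => [t|]; case: o' => [t'|] //.
- move=> e; move: (f1 t nla) => ns; congr Some; move: e; rewrite /arc_param /=.
  by case=> es; rewrite -es => /(mulfI ns).
- by move=> e; have := f1 t nla; rewrite e /= eqxx.
- by move=> e; have := f1 t' nla; rewrite -e /= eqxx.
Qed.

(** Unambiguous by [param_unique]; the default 0 is taken at the nucleus. *)
Definition arc_level (u : F * F) : F :=
  odflt 0 [pick la in A | (la != 0) && (form p.[la] u == la)].

Lemma arc_levelP u : u \in arc -> u != (0, 0) ->
  [/\ arc_level u \in A, arc_level u != 0 & form p.[arc_level u] u = arc_level u].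
Proof.
case/arc_affP => [->|[la [Ala nla hu]]]; rewrite ?eqxx // => _.
rewrite /arc_level; case: pickP => [x /= /and3P [h1 h2 /eqP h3] //|/(_ la)].
by rewrite Ala nla hu eqxx.
Qed.

Lemma arc_level0 : arc_level (0, 0) = 0.
Proof.
rewrite /arc_level; case: pickP => [x /= /and3P [_ nx]|] //.
by rewrite form00 eq_sym (negbTE nx).
Qed.

Lemma arc_level_in u : u \in arc -> arc_level u \in A.
Proof.
move=> hu; have [->|nu] := eqVneq u (0, 0); last by case: (arc_levelP hu nu).
by rewrite arc_level0 zmod_closed_0.
Qed.

(** Each conic has one point on such a line, so points are told apart by their level. *)
Lemma line_through_nucleus (a b : F) : (a, b) != (0, 0) ->
  (#|[set u in arc | (a * u.1 + b * u.2 == 0)%R]| <= 2 ^ d)%N.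
Proof.
move=> nab; rewrite -cA -(@card_in_imset _ _ arc_level).
  by apply: subset_leq_card; apply/subsetP => y /imsetP [u]; rewrite in_set => /andP [hu _] ->; apply: arc_level_in.
have dir u : a * u.1 + b * u.2 == 0 -> exists s, u = (s * b, s * a).
  case: u => x y /= e; have {}e : a * x = b * y by apply/eqP; rewrite -(addr_eq0_2 hF).
  have [b0|nb] := eqVneq b 0.
    have na : a != 0 by move: nab; rewrite b0 xpair_eqE eqxx andbT.
    exists (y / a); rewrite b0 mulr0 divfK //; congr (_, _).
    by apply: (mulfI na); rewrite e b0 mul0r mulr0.
  exists (x / b); rewrite divfK //; congr (_, _).
  by apply: (mulfI nb); rewrite -e; field.
have formZ al s : form al (s * b, s * a) = s ^+ 2 * form al (b, a) by rewrite /form /=; ring.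
move=> u u'; rewrite in_set => /andP [hu /dir [s us]].
rewrite in_set => /andP [hu' /dir [s' us']] e.
have [u0|nu] := eqVneq u (0, 0).
  have [-> //|nu'] := eqVneq u' (0, 0).
  by have [_ /negP []] := arc_levelP hu' nu'; rewrite -e u0 arc_level0.
have [Al nl hl] := arc_levelP hu nu.
have [u0'|nu'] := eqVneq u' (0, 0).
  by case/negP: nl; rewrite e u0' arc_level0.
have [_ _] := arc_levelP hu' nu'; rewrite -e => hl'.
have h1 : s ^+ 2 * form p.[arc_level u] (b, a) = arc_level u by rewrite -formZ -us.
have h2 : s' ^+ 2 * form p.[arc_level u] (b, a) = arc_level u by rewrite -formZ -us'.
suff ss : s = s' by rewrite us us' ss.
apply: (sqr_inj hF); apply: (@mulIf _ (form p.[arc_level u] (b, a))); last by rewrite h1 h2.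
by apply: contraNneq nl => f0; rewrite -h1 f0 mulr0.
Qed.

(** The line meets the conic of parameter la only if the resulting quadratic has trace
    0, i.e. if phi(la) = 1, where phi is additive: this is so for half of A or for
    none.  Each such conic has at most two points on the line. *)
Lemma line_off_nucleus (a b : F) :
  (#|[set u in arc | (a * u.1 + b * u.2 == 1)%R]| <= 2 ^ d)%N.
Proof.
pose phi (la : F) := Tr (la * p.[la] * b ^+ 2) + Tr (la * a ^+ 2) + Tr (la * (a * b)).
pose B := [set la in A | phi la == 1].
have phiD : {morph phi : x y / x + y}.
  by move=> x y; rewrite /phi hL !mulrDl !(TrD hF); ring.
have phi01 x : phi x = 0 \/ phi x = 1.
  by rewrite /phi -!(TrD hF); apply: (Tr_0_or_1 hF).
have cB : (#|B| * 2 <= 2 ^ d)%N.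
  have [B0|[x]] := set_0Vmem B; first by rewrite B0 cards0.
  rewrite inE => /andP [Ax /eqP hx].
  have := card_half hF hA phiD phi01 (ex_intro2 _ _ x Ax hx).
  have : (#|[set x in A | phi x == 0%R]| + #|B| = #|A|)%N.
    rewrite -(cardsID [set x | phi x == 0%R] A); congr (_ + _)%N.
      by apply: eq_card => y; rewrite !inE.
    apply: eq_card => y; rewrite !inE andbC; congr andb.
    by case: (phi01 y) => ->; rewrite ?eqxx ?oner_eq0 // eq_sym oner_eq0.
  by rewrite cA; move: #|_| #|B| (2 ^ d)%N => n1 n2 n3; lia.
apply: leq_trans cB; apply: (card_le_fibers (f := arc_level)).
  move=> u; rewrite in_set => /andP [hu /eqP line].
  have nu : u != (0, 0).
    by apply: contra_eq_neq line => ->; rewrite /= !mulr0 addr0 eq_sym oner_eq0.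
  have [Al nl hl] := arc_levelP hu nu.
  rewrite inE Al /=; move: (arc_level u) Al nl hl => la Al nl.
  case: u line {hu} nu => x y /= line nu hl.
  have h : (p.[la] + la * a ^+ 2) * x ^+ 2 + x * y + (1 + la * b ^+ 2) * y ^+ 2 = 0.
    have -> : (p.[la] + la * a ^+ 2) * x ^+ 2 + x * y + (1 + la * b ^+ 2) * y ^+ 2
      = form p.[la] (x, y) + la * ((a * x) ^+ 2 + (b * y) ^+ 2) by rewrite /form /=; ring.
    by rewrite hl -(sqrD2 hF) line expr1n mulr1 (addxx hF).
  have : Tr ((p.[la] + la * a ^+ 2) * (1 + la * b ^+ 2)) = 0.
    have [x0|nx] := eqVneq x 0.
      move: h; rewrite x0 expr0n mulr0 mul0r !add0r => /eqP.
      rewrite mulf_eq0 expf_eq0 => /orP [/eqP ->|/= /eqP y0]; first by rewrite mulr0 (Tr0 hF).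
      by rewrite x0 y0 eqxx in nu.
    have h' : p.[la] + la * a ^+ 2 + 1 * (y / x) + (1 + la * b ^+ 2) * (y / x) ^+ 2 = 0.
      by rewrite -[RHS](mul0r (x ^+ 2)^-1) -h; field.
    by have := Tr_quadratic_root hF (oner_neq0 F) h'; rewrite expr1n divr1.
  have -> : (p.[la] + la * a ^+ 2) * (1 + la * b ^+ 2)
    = p.[la] + la * p.[la] * b ^+ 2 + la * a ^+ 2 + (la * (a * b)) ^+ 2 by ring.
  rewrite !(TrD hF) (Tr_sqr hF) hTr // -!addrA => /eqP.
  by rewrite (addr_eq0_2 hF) /phi -!addrA eq_sym.
move=> la; rewrite inE => /andP [Ala _].
have [->|[u]] := set_0Vmem [set x in [set u in arc | a * u.1 + b * u.2 == 1] | arc_level x == la].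
  by rewrite cards0.
rewrite in_set => /andP []; rewrite in_set => /andP [hu /eqP line] /eqP ll.
(* (b, a) is the direction of the line, and the polar form at u and (b, a) is 1 *)
pose s0 := (form p.[la] (b, a))^-1.
pose T : {set F * F} := [set u; (u.1 + s0 * b, u.2 + s0 * a)].
have cT : (#|T| <= 2)%N by rewrite cards2; case: eqP.
apply: leq_trans cT.
apply: subset_leq_card; apply/subsetP => u'; rewrite in_set => /andP [].
rewrite in_set => /andP [hu' /eqP line'] /eqP ll'; rewrite /T !inE {T}.
have on w : w \in arc -> a * w.1 + b * w.2 = 1 -> arc_level w = la -> form p.[la] w = la.
  move=> hw lw <-; have nw : w != (0, 0).
    by apply: contra_eq_neq lw => ->; rewrite /= !mulr0 addr0 eq_sym oner_eq0.
  by case: (arc_levelP hw nw).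
have e := on u hu line ll; have e' := on u' hu' line' ll'.
case: u u' line line' e e' {hu hu' ll ll'} => x y [x' y'] /= line line' e e'.
have [s [sx sy]] : exists s, x' = x + s * b /\ y' = y + s * a.
  have dl : a * (x' - x) = b * (y - y').
    by apply/eqP; rewrite -subr_eq0; apply/eqP; rewrite -[RHS](subrr (1 : F)) -{1}line' -line; ring.
  have [b0|nb] := eqVneq b 0.
    have na : a != 0.
      by apply: contra_eq_neq line => ->; rewrite b0 !mul0r addr0 eq_sym oner_eq0.
    exists ((y' - y) / a); split; last by field.
    by apply/eqP; rewrite b0 mulr0 addr0 -subr_eq0; apply/eqP/(mulfI na); rewrite dl b0 mul0r mulr0.
  exists ((x' - x) / b); split; first by field.
  have -> : (x' - x) / b * a = a * (x' - x) / b by ring.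
  rewrite dl mulrAC divff // mul1r (oppx hF).
  by rewrite addrA (addxx hF) add0r.
have {line' e'} : s * (1 + s * form p.[la] (b, a)) = 0.
  have -> : s * (1 + s * form p.[la] (b, a)) = form p.[la] (x', y') - form p.[la] (x, y)
      - 2 * (p.[la] * x * (s * b) + y * (s * a)) by rewrite sx sy -{1}line /form /=; ring.
  by rewrite e e' (two0 hF) mul0r subr0 subrr.
move/eqP; rewrite mulf_eq0 => /orP [/eqP s0'|].
  by rewrite sx sy s0' !mul0r !addr0 eqxx.
rewrite (addr_eq0_2 hF) => /eqP sf; rewrite sx sy (_ : s = s0) ?eqxx ?orbT //.
by rewrite /s0 -[RHS]mul1r sf mulfK //; apply: contra_eq_neq sf => ->; rewrite mulr0 oner_eq0.
Qed.

Theorem pq_arc_maximal : maximal_arc (2 ^ d) (pq_arc p 1 A).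
Proof.
rewrite (pq_arc_affine hF hTr); split.
- by apply/subsetP => P /imsetP [u _ ->]; apply: aff_PG2.
- by rewrite card_imset ?card_arc_aff //; apply: aff_inj.
move=> S SK cS colS.
pose S' := aff @^-1: S.
have SE : S = aff @: S'.
  apply/setP => P; apply/idP/imsetP => [PS|[u]]; last by rewrite inE => h ->.
  have /imsetP [u _ Pu] := subsetP SK P PS.
  by exists u; rewrite // inE -Pu.
have S'K : S' \subset arc.
  apply/subsetP => u; rewrite inE => /(subsetP SK) /imsetP [u' hu' /aff_inj -> //].
have cS' : #|S'| = (2 ^ d).+1 by rewrite -cS SE card_imset //; apply: aff_inj.
have [u1 [u2 [S1 S2 n12]]] : exists u1 u2, [/\ u1 \in S', u2 \in S' & u1 != u2].
  have : (1 < #|S'|)%N by rewrite cS' ltnS expn_gt0.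
  by move/card_gt1P => [u1 [u2 [h1 h2 h3]]]; exists u1, u2.
rewrite SE in colS.
pose a := u1.2 - u2.2; pose b := u2.1 - u1.1; pose c := u1.1 * u2.2 - u2.1 * u1.2.
have line u : u \in S' -> a * u.1 + b * u.2 + c = 0.
  by move=> hu; apply: collinear_aff colS S1 S2 hu n12.
have nab : (a, b) != (0, 0).
  apply: contraNneq n12 => -[/eqP a0 /eqP b0].
  rewrite [u1]surjective_pairing [u2]surjective_pairing; apply/eqP; congr (_, _).
    by apply/esym/eqP; rewrite -subr_eq0.
  by apply/eqP; rewrite -subr_eq0.
have [c0|nc] := eqVneq c 0.
  have : (#|S'| <= 2 ^ d)%N; last by rewrite cS' ltnn.
  apply: leq_trans (line_through_nucleus nab); apply: subset_leq_card.
  apply/subsetP => u hu; rewrite in_set (subsetP S'K) //=.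
  by have := line u hu; rewrite c0 addr0 => ->.
have : (#|S'| <= 2 ^ d)%N; last by rewrite cS' ltnn.
apply: leq_trans (line_off_nucleus (a / c) (b / c)); apply: subset_leq_card.
apply/subsetP => u hu; rewrite in_set (subsetP S'K) //=.
have /eqP := line u hu; rewrite (addr_eq0_2 hF) => /eqP e.
have -> : a / c * u.1 + b / c * u.2 = (a * u.1 + b * u.2) / c by field.
by rewrite e divff.
Qed.

End MaximalArc.

(** * Affine maps give Denniston arcs *)

Section DennistonSets.
Variables (F : finFieldType) (m : nat).
Hypothesis hF : #|F| = (2 ^ m)%N.
Local Notation frob := (frobenius (pchar2 hF)).
Local Notation sqrt := (frob m.-1).

Lemma image_pt (g : 'M[F]_3) v : [set w *m g | w in pt v] = pt (v *m g).
Proof.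
apply/setP => w; apply/imsetP/imsetP => [[_ /imsetP [a _ ->] ->]|[a _ ->]].
  by exists a; rewrite // scalemxAl.
by exists (a *: v); rewrite ?scalemxAl //; apply: imset_f.
Qed.

Definition binary_form (a h b : F) (u : F * F) : F := a * u.1 ^+ 2 + h * u.1 * u.2 + b * u.2 ^+ 2.

Lemma denniston_affine a h b (A : {set F}) :
  denniston_set a h b A = aff @: [set u | binary_form a h b u \in A].
Proof.
apply/setP => P; apply/imset2P/imsetP => [[x y _]|[u]].
  by rewrite inE /= => hA ->; exists (x, y); rewrite ?inE.
by rewrite inE => hu ->; exists u.1 u.2; rewrite ?inE.
Qed.

Definition elation (s : F) : 'M[F]_3 :=
  \matrix_(i, j) (if i == j then 1 else if (i == 0) && (j == 2) then s else 0).

Lemma vec3_elation s x y z : vec3 x y z *m elation s = vec3 x y (z + s * x).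
Proof.
apply/rowP => -[[|[|[|//]]] h]; rewrite !mxE !big_ord_recl big_ord0 !mxE /=; ring.
Qed.

Lemma elation_invol s : elation s *m elation s = 1%:M.
Proof.
apply/row_matrixP => i; rewrite row_mul -[elation s]mul1mx row_mul.
rewrite [row i 1%:M]vec3_eta mul1mx !vec3_elation.
by rewrite -addrA (addxx hF) addr0.
Qed.

(** Over A the form of parameter la equals the one of a0 plus a1 la x^2, and
    la z^2 + a1 la x^2 = la (z + sqrt(a1) x)^2. *)
Theorem affine_map_denniston (A : {set F}) d (p : {poly F}) (a0 a1 : F) :
    zmod_closed A -> #|A| = (2 ^ d)%N ->
    (forall la, la \in A -> la != 0 -> Tr p.[la] = 1) ->
    Tr a0 = 1 -> (forall la, la \in A -> p.[la] = a0 + a1 * la) ->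
  denniston (pq_arc p 1 A).
Proof.
move=> hA cA hTr ha0 hp; pose s := sqrt a1.
have s2 : s ^+ 2 = a1 by apply: sqrtK.
exists a0, 1, 1, A, (elation s); split=> //.
- exact: oner_neq0.
- by rewrite expr1n mulr1 divr1.
- by have [] := mulmx1_unit (elation_invol s).
have formE u la : la \in A -> form p.[la] u + la = binary_form a0 1 1 u + la * (1 + s * u.1) ^+ 2.
  move=> Ala; rewrite (hp _ Ala) (sqrD2 hF) expr1n exprMn s2 /form /binary_form; ring.
have bformE u : binary_form a0 1 1 u = form a0 u by rewrite /binary_form /form !mul1r.
have bformZ u k : binary_form a0 1 1 (u.1 / k, u.2 / k) = binary_form a0 1 1 u / k ^+ 2.
  by rewrite /binary_form /= -exprVn; ring.
have formZ (al : F) u k : form al (u.1 / k, u.2 / k) = form al u / k ^+ 2.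
  by rewrite /form /= -exprVn; ring.
have nform (al : F) u : Tr al = 1 -> form al u = 0 -> u = (0, 0).
  by case: u => x y hal; rewrite /form /= => /(form_anisotropic hF hal) [-> ->].
rewrite (pq_arc_affine hF hTr) denniston_affine.
apply/setP => P; apply/imsetP/imsetP.
  case=> u /arc_affP hu ->.
  case: hu => [->|[la [Ala nla hu]]].
    exists (aff (0, 0)); last by rewrite image_pt vec3_elation mulr0 addr0.
    by apply: imset_f; rewrite inE bformE form00 zmod_closed_0.
  pose z := 1 + s * u.1.
  have hd : binary_form a0 1 1 u = la * z ^+ 2.
    by apply/eqP; rewrite -(addr_eq0_2 hF) -formE // hu (addxx hF).
  have nz : z != 0.
    apply: contraNneq nla => z0; move: hd; rewrite z0 expr0n mulr0 bformE => /(nform _ _ ha0) u0.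
    by rewrite -hu u0 form00.
  exists (aff (u.1 / z, u.2 / z)).
    by apply: imset_f; rewrite inE bformZ hd mulfK // expf_neq0.
  rewrite image_pt vec3_elation /aff -[RHS](pt_scale _ nz) scale_vec3 /=; congr (pt (vec3 _ _ _)).
  - by rewrite mulrC divfK.
  - by rewrite mulrC divfK.
  - have -> : z * (1 + s * (u.1 / z)) = z + s * u.1 by field.
    by rewrite /z -addrA (addxx hF) addr0.
case=> _ /imsetP [u hu ->] ->; move: hu; rewrite inE; set la := binary_form _ _ _ _ => Ala.
rewrite image_pt vec3_elation; pose z := 1 + s * u.1; rewrite -/z.
have [l0|nla] := eqVneq la 0.
  exists (0, 0); first by apply/arc_affP; left.
  by rewrite /z; have -> : u = (0, 0); [apply: (nform _ _ ha0); rewrite -bformE | rewrite mulr0 addr0].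
have hd : form p.[la] u = la * z ^+ 2.
  apply/eqP; rewrite -(addr_eq0_2 hF).
  have -> : form p.[la] u = form p.[la] u + la + la by rewrite -addrA (addxx hF) addr0.
  rewrite formE // -/la -/z.
  have -> : la + la * z ^+ 2 + la + la * z ^+ 2 = 2 * (la + la * z ^+ 2) by ring.
  by rewrite (two0 hF) mul0r.
have nz : z != 0.
  have tr1 := hTr _ Ala nla.
  apply: contraNneq nla => z0; move: hd; rewrite z0 expr0n mulr0 => /(nform _ _ tr1) u0.
  by rewrite /la u0 bformE form00.
exists (u.1 / z, u.2 / z); last by rewrite pt_vec3.
by apply/arc_affP; right; exists la; split=> //; rewrite formZ hd mulfK // expf_neq0.
Qed.

Lemma mathon_poly_coefs d (p : {poly F}) : mathon_poly d p ->
  exists al : nat -> F, forall x, p.[x] = \sum_(l < d) al l * x ^+ (2 ^ l - 1).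
Proof.
case=> a ->; exists (fun l => oapp a 0 (insub l)) => x.
rewrite horner_sum; apply: eq_bigr => i _.
by rewrite hornerZ hornerXn valK.
Qed.

Lemma mathon_poly_additive d (p : {poly F}) : mathon_poly d p ->
  forall x y, (x + y) * p.[x + y] = x * p.[x] + y * p.[y].
Proof.
move=> /mathon_poly_coefs [al hp].
have E x : x * p.[x] = \sum_(l < d) al l * frob l x.
  rewrite hp mulr_sumr; apply: eq_bigr => l _; rewrite mulrCA -exprS /frobenius.
  by congr (_ * _ ^+ _); rewrite -subSn ?expn_gt0 // subn1.
move=> x y; rewrite !E -big_split; apply: eq_bigr => l _.
by rewrite rmorphD mulrDr.
Qed.

(** The constant term has trace 1 because the trace condition extends to 0. *)
Theorem large_p1_map_denniston d (p : {poly F}) (A : {set F}) :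
    m != 9%N -> (0 < d)%N -> (m + 3 <= d.*2)%N -> is_pq_map d p 1 A -> denniston (pq_arc p 1 A).
Proof.
move=> m9 d0 hd [/mathon_poly_coefs [al hp] _ hA cA hTr].
have hTr' la : la \in A -> la != 0 -> Tr p.[la] = 1.
  by move=> Ala nla; rewrite -(hTr la Ala nla) hornerC mulr1.
have hTr2 x : x \in A -> x != 0 -> Tr (\sum_(l < d) al l * x ^+ (2 ^ l - 1)) = 1.
  by move=> Ax nx; rewrite -hp hTr'.
have al0 := trace_one_poly_affine hF hA cA hd m9 hTr2.
have m0 := m_gt0 hF.
have hp' x : p.[x] = al 0%N + al 1%N * x.
  have [n dn] : exists n, d = n.+2 by exists d.-2; lia.
  rewrite hp; move: (al0); rewrite dn => al0'; rewrite !big_ord_recl big1 ?addr0 /= => [|i _].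
    by rewrite expr0 mulr1 expr1.
  by rewrite al0' ?mul0r //= /bump /=; have := ltn_ord i; lia.
apply: (affine_map_denniston hA cA hTr' (a0 := al 0%N) (a1 := al 1%N)) => [|la _]; last exact: hp'.
have := Tr_poly_all hF hA cA hTr2 d0 (zmod_closed_0 hA).
by rewrite -hp hp' mulr0 addr0.
Qed.

End DennistonSets.

(** * Denniston arcs come from affine maps *)

Section NonDenniston.
Variables (F : finFieldType) (m : nat).
Hypothesis hF : #|F| = (2 ^ m)%N.
Local Notation frob := (frobenius (pchar2 hF)).
Local Notation sqrt := (frob m.-1).

Section Dform.
Variables (a h b : F).
Hypotheses (nh : h != 0) (hab : Tr (a * b / h ^+ 2) = 1).

Lemma binary_form_neq0 u : u != (0, 0) -> binary_form a h b u != 0.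
Proof.
case: u => x y nu; apply/eqP; rewrite /binary_form /= => e.
have nb : b != 0.
  apply/eqP => b0; move: hab; rewrite b0 mulr0 mul0r (Tr0 hF) => /esym/eqP.
  by rewrite oner_eq0.
have [x0|nx] := eqVneq x 0.
  move: e; rewrite x0 expr0n !mulr0 mul0r !add0r => /eqP.
  rewrite mulf_eq0 (negbTE nb) expf_eq0 /= => /eqP y0.
  by rewrite x0 y0 eqxx in nu.
have e' : a + h * (y / x) + b * (y / x) ^+ 2 = 0.
  by rewrite -[RHS](mul0r (x ^+ 2)^-1) -e; field.
by move/eqP: hab; rewrite (Tr_quadratic_root hF nh e') eq_sym oner_eq0.
Qed.

(** The form takes each nonzero value once in each non-vertical direction. *)
Lemma card_binary_form_ge (A : {set F}) :
  (#|A :\ 0%R| * #|F| <= #|[set u | binary_form a h b u \in A]|)%N.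
Proof.
rewrite -cardsT -cardsX.
have nD t : binary_form a h b (1, t) != 0 by apply: binary_form_neq0; rewrite xpair_eqE oner_eq0.
pose f (x : F * F) := let s := sqrt (x.1 / binary_form a h b (1, x.2)) in (s, s * x.2).
have bformZ s t : binary_form a h b (s, s * t) = s ^+ 2 * binary_form a h b (1, t).
  by rewrite /binary_form /=; ring.
have fE x : binary_form a h b (f x) = x.1 by rewrite bformZ sqrtK divfK.
have f1 x : x.1 != 0 -> (f x).1 != 0.
  by move=> nx; rewrite /= fmorph_eq0 mulf_neq0 // invr_eq0.
rewrite -(@card_in_imset _ _ f) => [|x x'].
  apply: subset_leq_card; apply/subsetP => u /imsetP [x].
  by rewrite !inE andbT => /andP [_ Ax] ->; rewrite fE.
rewrite !inE !andbT => /andP [nx _] _ e; have e1 : x.1 = x'.1 by rewrite -!fE e.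
have := congr1 fst e; have := congr1 snd e; rewrite [x]surjective_pairing [x']surjective_pairing.
move: (f1 x nx); rewrite /= => ns h2 h1; congr (_, _) => //.
by apply: (mulfI ns); rewrite h2 -h1.
Qed.

End Dform.

Lemma card_projective_image (g : 'M[F]_3) (K : {set {set 'rV[F]_3}}) :
  g \in unitmx -> #|projective_image g K| = #|K|.
Proof.
move=> ug; apply: card_imset; apply: imset_inj.
exact: can_inj (mulmxK ug).
Qed.

(** Otherwise the first two columns are parallel. *)
Lemma unit_minor_neq0 (H : 'M[F]_3) : H \in unitmx ->
  ~ (forall i j, H i 0 * H j 1 + H j 0 * H i 1 = 0).
Proof.
move=> uH minors.
have kerH (y : 'cV[F]_3) : H *m y = 0 -> y = 0.
  by move=> h; rewrite -[y](mulKmx uH) h mulmx0.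
have [i hi|h0] := pickP [pred i | (H i 0 != 0) || (H i 1 != 0)].
  have : \col_(j < 3) [:: H i 1; H i 0; 0]`_j = 0.
    apply: kerH; apply/colP => j; rewrite !mxE !big_ord_recl big_ord0 !mxE /=.
    have := minors i j; rewrite mulr0 !addr0 => <-.
    rewrite addrC mulrC; congr (_ * H _ _ + _ * H _ _); exact: val_inj.
  move=> /colP y0; move: hi; have := (y0 0, y0 1); rewrite !mxE /= => -[-> ->].
  by rewrite eqxx.
have : delta_mx 0 0 = 0 :> 'cV[F]_3.
  apply: kerH; rewrite -colE; apply/colP => i; rewrite !mxE.
  by have /negbT := h0 i; rewrite negb_or !negbK => /andP [/eqP -> _].
by move/colP/(_ 0); rewrite !mxE /= => /eqP; rewrite oner_eq0.
Qed.

Variables (A : {set F}) (d : nat) (p : {poly F}).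
Hypotheses (hA : zmod_closed A) (cA : #|A| = (2 ^ d)%N).
Hypothesis hTr : forall la, la \in A -> la != 0 -> Tr p.[la] = 1.
Hypothesis hL : forall x y : F, (x + y) * p.[x + y] = x * p.[x] + y * p.[y].
Hypothesis hdm : (d.+2 <= m)%N.

(** Fix la and parametrize the points of its conic by (1, t, z).  The q values of t are
    spread over fewer than 2^d conics of the Denniston pencil, so five of them fall
    on one; eliminating z gives a quartic in t, whose vanishing identifies the two
    quadratic forms up to the factor c 0 1, which does not depend on la.  The pencil
    varies by multiples of a squared linear form, which gives the proportion. *)
Theorem denniston_pencil : denniston (pq_arc p 1 A) ->
  exists r s : F, forall la la', la \in A -> la != 0 -> la' \in A -> la' != 0 ->
    (p.[la] + p.[la']) * r = (la + la') * s /\ (r = 0 -> la = la').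
Proof.
case=> a [h [b [A' [g [nh hab hA' ug KE]]]]].
have sq2 (x y t : F) : (x + y * t) ^+ 2 = x ^+ 2 + y ^+ 2 * t ^+ 2.
  by rewrite (sqrD2 hF) exprMn.
have sq3 (x y w t : F) :
    (x + y * t + w * t ^+ 2) ^+ 2 = x ^+ 2 + y ^+ 2 * t ^+ 2 + w ^+ 2 * t ^+ 4.
  by rewrite !(sqrD2 hF) !exprMn; ring.
have cA' : (#|A'| <= 2 ^ d)%N.
  have [_ cK _] := pq_arc_maximal hF hA cA hTr hL.
  move: cK; rewrite KE card_projective_image // denniston_affine card_imset; last exact: aff_inj.
  move=> cD; have := card_binary_form_ge nh hab A'; rewrite cD hF.
  have cA0 : #|A'| = #|A' :\ 0%R|.+1 by rewrite [LHS](cardsD1 0%R) (zmod_closed_0 hA').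
  have lt : (2 ^ d < 2 ^ m)%N by rewrite ltn_exp2l //; lia.
  move=> le; rewrite cA0 ltnNge; apply/negP => le2.
  have d0 : (0 < 2 ^ d)%N by rewrite expn_gt0.
  have : (2 ^ m * 2 ^ d <= 2 ^ m * (2 ^ d - 1) + 2 ^ d)%N.
    apply: leq_trans le; rewrite mulnC leq_mul2r le2 orbT //.
  have -> : (2 ^ m * 2 ^ d = 2 ^ m * (2 ^ d - 1) + 2 ^ m)%N.
    by rewrite mulnBr muln1 subnK // leq_pmulr.
  by rewrite leq_add2l leqNgt lt.
pose H := invmx g; have uH : H \in unitmx by rewrite unitmx_inv.
pose z la t := sqrt ((p.[la] + t + t ^+ 2) / la).
pose w la t j := H 0 j + t * H 1 j + z la t * H 2 j.
have zE la t : la != 0 -> la * z la t ^+ 2 = p.[la] + t + t ^+ 2.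
  by move=> nla; rewrite sqrtK mulrC divfK.
have vH la t : vec3 1 t (z la t) *m H = vec3 (w la t 0) (w la t 1) (w la t 2).
  rewrite [LHS]vec3_eta; congr vec3; rewrite !mxE !big_ord_recl big_ord0 !mxE /= /w;
    rewrite mul1r addr0 addrA; congr (_ + _ * H _ _ + _ * H _ _); exact: val_inj.
have onD la t : la \in A -> la != 0 ->
    exists2 mu, mu \in A' & w la t 2 != 0 /\ binary_form a h b (w la t 0, w la t 1) = mu * w la t 2 ^+ 2.
  move=> Ala nla; have nv : vec3 1 t (z la t) != 0 by rewrite vec3_eq0 oner_eq0.
  have : pt (vec3 1 t (z la t)) \in pq_arc p 1 A.
    rewrite !inE; apply/orP; right; apply/bigcupP; exists la; first by rewrite !inE nla.
    apply: imset_f; rewrite inE nv hornerC /=; have [-> -> ->] := vec3E 1 t (z la t).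
    by rewrite zE // expr1n mulr1 !mul1r (addxx hF).
  rewrite KE denniston_affine => /imsetP [_ /imsetP [u hu ->]]; rewrite image_pt.
  move/(pt_eqP nv) => [k nk] /(congr1 (mulmx^~ H)).
  rewrite vH -scalemxAl mulmxK // scale_vec3 => /vec3_inj [-> -> ->].
  exists (binary_form a h b u); first by rewrite inE in hu.
  by rewrite mulr1; split=> //; rewrite /binary_form /=; ring.
(* q and c are the diagonal and mixed coefficients of the form after the change of
   coordinates H; squares of linear forms only affect the diagonal *)
pose q i := binary_form a h b (H i 0, H i 1).
pose c i j := h * (H i 0 * H j 1 + H j 0 * H i 1).
have key la : la \in A -> la != 0 -> exists mu,
    [/\ c 0 2 = 0, c 1 2 = 0, q 2 + mu * H 2 2 ^+ 2 = la * c 0 1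
      & q 0 + mu * H 0 2 ^+ 2 = p.[la] * c 0 1].
  move=> Ala nla.
  pose mu t := binary_form a h b (w la t 0, w la t 1) / w la t 2 ^+ 2.
  have muE t : mu t \in A' /\ binary_form a h b (w la t 0, w la t 1) = mu t * w la t 2 ^+ 2.
    have [mu0 Amu [nw e]] := onD la t Ala nla.
    by rewrite /mu e mulfK ?expf_neq0.
  have [/existsP [mu0 big]|] := boolP [exists mu0 : F, (4 < #|[set t in [set t | mu t != 0%R] | mu t == mu0]|)%N].
    exists mu0; pose cc := (q 2 + mu0 * H 2 2 ^+ 2) / la.
    have := @quartic_eq0 F
      (la * (q 0 + mu0 * H 0 2 ^+ 2 + cc * p.[la]) ^+ 2 + p.[la] * c 0 2 ^+ 2)
      (c 0 2 ^+ 2)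
      (la * (c 0 1 + cc) ^+ 2 + c 0 2 ^+ 2 + p.[la] * c 1 2 ^+ 2)
      (c 1 2 ^+ 2)
      (la * (q 1 + mu0 * H 1 2 ^+ 2 + cc) ^+ 2 + c 1 2 ^+ 2) _ _ big.
    case=> [t|e0 e1 e2 e3 _].
      rewrite inE => /andP [_ /eqP mut]; have [_] := muE t; rewrite mut => e.
      have ze := zE la t nla.
      pose U := (q 0 + mu0 * H 0 2 ^+ 2 + cc * p.[la]) + (c 0 1 + cc) * t
                + (q 1 + mu0 * H 1 2 ^+ 2 + cc) * t ^+ 2.
      pose V := c 0 2 + c 1 2 * t.
      have UV : U + z la t * V = 0.
        have ccE : cc * (p.[la] + t + t ^+ 2) = (q 2 + mu0 * H 2 2 ^+ 2) * z la t ^+ 2.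
          by rewrite -ze mulrA /cc divfK.
        have -> : U = (q 0 + mu0 * H 0 2 ^+ 2) + c 0 1 * t + (q 1 + mu0 * H 1 2 ^+ 2) * t ^+ 2
           + cc * (p.[la] + t + t ^+ 2) by rewrite /U; ring.
        (* the cross terms of the three squares, which cancel in characteristic 2 *)
        pose R k := t * H 0 k * H 1 k + z la t * H 0 k * H 2 k + t * z la t * H 1 k * H 2 k.
        rewrite ccE; transitivity (binary_form a h b (w la t 0, w la t 1) + mu0 * w la t 2 ^+ 2
            - 2 * (a * R 0 + b * R 1 + mu0 * R 2)).
          by rewrite /V /q /c /R /w /binary_form /=; ring.
        by rewrite e (addxx hF) (two0 hF) mul0r subrr.
      have U2 : U ^+ 2 = z la t ^+ 2 * V ^+ 2.
        by rewrite -exprMn; congr (_ ^+ 2); apply/eqP; rewrite -(addr_eq0_2 hF) UV.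
      have -> : 0 = la * (U ^+ 2 + z la t ^+ 2 * V ^+ 2) by rewrite U2 (addxx hF) mulr0.
      (* squaring U = z V removes z, since la z^2 = p + t + t^2 *)
      have Usq : U ^+ 2 = _ := sq3 _ _ _ _.
      have Vsq : V ^+ 2 = _ := sq2 _ _ _.
      by rewrite mulrDr [la * (_ * V ^+ 2)]mulrA ze Usq Vsq; ring.
    have c02 : c 0 2 = 0 by apply/eqP; move/eqP: e1; rewrite expf_eq0.
    have c12 : c 1 2 = 0 by apply/eqP; move/eqP: e3; rewrite expf_eq0.
    move: e2 e0; rewrite c02 c12 expr0n !mulr0 !addr0 => /eqP.
    rewrite mulf_eq0 (negbTE nla) expf_eq0 /= (addr_eq0_2 hF) => /eqP c01 /eqP.
    rewrite mulf_eq0 (negbTE nla) expf_eq0 /= (addr_eq0_2 hF) => /eqP e0.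
    split; [exact: erefl|exact: erefl| |]; rewrite c01.
      by rewrite /cc [RHS]mulrC divfK.
    by rewrite e0; exact: mulrC.
  rewrite negb_exists => /forallP small; exfalso.
  have big : (#|[set t | mu t != 0%R]| <= #|A' :\ 0%R| * 4)%N.
    apply: (card_le_fibers (f := mu)) => [t|mu0 _]; last by rewrite leqNgt.
    by rewrite !inE => ->; case: (muE t).
  (* mu = 0 is taken at the nucleus of the pencil only; a bound 4 for all values of mu
     would give 2^(d+2) in total, which may equal q *)
  have one : (#|[set t | mu t == 0%R]| <= 1)%N.
    have w0 t : mu t = 0 -> w la t 0 = 0 /\ w la t 1 = 0.
      move=> mt; have [_] := muE t; rewrite mt mul0r => e.
      have : (w la t 0, w la t 1) == (0, 0).
        by apply: contraLR (eqxx (0 : F)) => /(binary_form_neq0 nh hab); rewrite e.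
      by rewrite xpair_eqE => /andP [/eqP -> /eqP ->].
    apply/card_le1_eqP => t t'; rewrite !inE => /eqP /w0 [h0 h1] /eqP /w0 [h0' h1'].
    have [_ _ [nw _]] := onD la t Ala nla.
    have : vec3 1 t' (z la t') = (w la t' 2 / w la t 2) *: vec3 1 t (z la t).
      apply: (can_inj (mulmxK uH)); rewrite -scalemxAl !vH h0 h1 h0' h1' scale_vec3 !mulr0.
      by rewrite divfK.
    rewrite scale_vec3 mulr1 => /vec3_inj [<- -> _]; by rewrite mul1r.
  have cF : #|F| = (#|[set t | mu t == 0%R]| + #|[set t | mu t != 0%R]|)%N.
    rewrite -cardsT -(cardsID [set t | mu t == 0%R] setT); congr (_ + _)%N.
      by rewrite setTI.
    by apply: eq_card => t; rewrite !inE andbT.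
  have cA0 : #|A'| = #|A' :\ 0%R|.+1 by rewrite [LHS](cardsD1 0%R) (zmod_closed_0 hA').
  have : (2 ^ d.+2 <= 2 ^ m)%N by rewrite leq_exp2l.
  rewrite -hF cF !expnS; move: one big cA'; rewrite cA0.
  move: #|_| #|_| #|_| (2 ^ d)%N => n1 n2 n3 n4; lia.
have nc la : la \in A -> la != 0 -> c 0 1 != 0.
  move=> Ala nla; have [mu [c02 c12 _ _]] := key la Ala nla.
  apply/eqP => c01; apply: (unit_minor_neq0 uH) => i j.
  have cij : c i j = 0.
    have sym x y : c x y = c y x by rewrite /c addrC.
    have dg x : c x x = 0 by rewrite /c (addxx hF) mulr0.
    have i3 (x : 'I_3) : [\/ x = 0, x = 1 | x = 2].
      by case: x => -[|[|[|//]]] hx; [constructor 1|constructor 2|constructor 3]; apply: val_inj.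
    by case: (i3 i) => ->; case: (i3 j) => ->; rewrite ?dg // ?c01 ?c02 ?c12 // sym.
  by move/eqP: cij; rewrite /c mulf_eq0 (negbTE nh) => /eqP.
exists (H 2 2 ^+ 2), (H 0 2 ^+ 2) => la la' Ala nla Ala' nla'.
have [mu [_ _ h1 h2]] := key la Ala nla.
have [mu' [_ _ h1' h2']] := key la' Ala' nla'.
have nc01 := nc la Ala nla.
have e1 : (la + la') * c 0 1 = (mu + mu') * H 2 2 ^+ 2.
  rewrite mulrDl -h1 -h1' -[RHS]add0r -(addxx hF (q 2)); ring.
have e2 : (p.[la] + p.[la']) * c 0 1 = (mu + mu') * H 0 2 ^+ 2.
  rewrite mulrDl -h2 -h2' -[RHS]add0r -(addxx hF (q 0)); ring.
split.
  apply: (mulIf nc01); rewrite mulrAC e2 [RHS]mulrAC e1; ring.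
move=> H22; move/eqP: e1; rewrite H22 mulr0 mulf_eq0 (negbTE nc01) orbF (addr_eq0_2 hF).
by move/eqP.
Qed.

End NonDenniston.

(** * An isotropic subgroup for the cubic trace form *)

Section Existence.
Variables (F : finFieldType) (m : nat).
Hypothesis hF : #|F| = (2 ^ m)%N.
Local Notation frob := (frobenius (pchar2 hF)).

Implicit Types (A : {set F}) (u v x c : F).

Definition adjoin (A : {set F}) (x : F) : {set F} := [set u | (u \in A) || (u + x \in A)].

Lemma sub_adjoin A x u : u \in A -> u \in adjoin A x.
Proof. by rewrite inE => ->. Qed.

Lemma mem_adjoin A x : zmod_closed A -> x \in adjoin A x.
Proof. by move=> hA; rewrite inE (addxx hF) zmod_closed_0 ?orbT. Qed.

Lemma adjoin_closed A x : zmod_closed A -> zmod_closed (adjoin A x).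
Proof.
move=> hA; split=> [|u v]; first by rewrite inE zmod_closed_0.
have E : (u + x) + (v + x) = u + v by rewrite addrACA (addxx hF) addr0.
rewrite !inE (oppx hF) => /orP [Au|Au] /orP [Av|Av]; apply/orP.
- by left; apply: (zmod_closed_add hF).
- by right; rewrite -addrA; apply: (zmod_closed_add hF).
- by right; rewrite addrAC; apply: (zmod_closed_add hF).
- by left; rewrite -E; apply: (zmod_closed_add hF).
Qed.

Lemma adjoinP A x u : u \in adjoin A x -> exists2 v, v \in A & u = v \/ u = x + v.
Proof.
rewrite inE => /orP [Au|Au]; first by exists u => //; left.
by exists (u + x) => //; right; rewrite addrC -addrA (addxx hF) addr0.
Qed.

Lemma card_adjoin A x : zmod_closed A -> x \notin A -> #|adjoin A x| = (#|A| * 2)%N.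
Proof.
move=> hA nx; have -> : adjoin A x = A :|: [set u + x | u in A].
  apply/setP => u; rewrite !inE; congr orb; apply/idP/imsetP => [Au|[v Av ->]].
    by exists (u + x); rewrite // -addrA (addxx hF) addr0.
  by rewrite -addrA (addxx hF) addr0.
rewrite cardsU card_imset ?muln2 -?addnn; last exact: addIr.
rewrite (_ : _ :&: _ = set0) ?cards0 ?subn0 //; apply/setP => u; rewrite !inE.
apply/negP => /andP [Au /imsetP [v Av uv]]; case/negP: nx.
by rewrite -(zmod_closed_addr hF x hA Av) -uv.
Qed.

(** Otherwise A and the larger group would have the same orthogonal space. *)
Lemma separate (A : {set F}) x : zmod_closed A -> x \notin A ->
  exists2 c, c \in perp A & Tr (c * x) = 1.
Proof.
move=> hA nx.
have [/exists_inP [c h1 /eqP h2]|h] := boolP [exists c in perp A, Tr (c * x) == 1]; first by exists c.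
exfalso; have sub : perp A \subset perp (adjoin A x).
  apply/subsetP => c hc; apply/perpP => u /adjoinP [v Av].
  have Tv := perpP _ _ hc v Av.
  have Tx : Tr (c * x) = 0.
    by case: (Tr_0_or_1 hF (c * x)) => // /eqP e; case/negP: h; apply/exists_inP; exists c.
  by case=> ->; rewrite // mulrDr (TrD hF) Tx Tv addr0.
have := subset_leq_card sub; have := card_perp hF hA; have := card_perp hF (adjoin_closed x hA).
rewrite card_adjoin // => e1 e2; have : (0 < 2 ^ m)%N by rewrite expn_gt0.
rewrite -{1}e2 muln_gt0 => /andP [a0 b0] le.
have : (#|A| * 2 * #|perp A| <= #|A| * #|perp A|)%N by rewrite e2 -e1 leq_mul2l le orbT.
rewrite mulnAC -[leqRHS]muln1 leq_mul2l muln_eq0; lia.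
Qed.

Definition bil (u v : F) : F := Tr (u ^+ 2 * v + u * v ^+ 2).

Lemma bilC u v : bil u v = bil v u.
Proof. by rewrite /bil; congr Tr; ring. Qed.

Lemma bilDl u v w : bil (u + v) w = bil u w + bil v w.
Proof. by rewrite /bil -(TrD hF) (sqrD2 hF); congr Tr; ring. Qed.

Lemma bil_diag u : bil u u = 0.
Proof. by rewrite /bil -exprSr -exprS (addxx hF) (Tr0 hF). Qed.

Lemma Tr_cubeD u v : Tr ((u + v) ^+ 3) = Tr (u ^+ 3) + Tr (v ^+ 3) + bil u v.
Proof.
rewrite /bil -!(TrD hF); congr Tr.
have -> : (u + v) ^+ 3 = u ^+ 3 + v ^+ 3 + (u ^+ 2 * v + u * v ^+ 2) + 2 * (u ^+ 2 * v + u * v ^+ 2) by ring.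
by rewrite (two0 hF) mul0r addr0.
Qed.

Definition bperp (A : {set F}) : {set F} := [set u | [forall v in A, bil u v == 0]].

Lemma bperpP (A : {set F}) u : reflect (forall v, v \in A -> bil u v = 0) (u \in bperp A).
Proof.
rewrite inE; apply: (iffP forall_inP) => h x hx; first exact/eqP/h.
by apply/eqP/h.
Qed.

Lemma bil0l v : bil 0 v = 0.
Proof. by rewrite /bil expr0n !mul0r addr0 (Tr0 hF). Qed.

Lemma bperp_closed (A : {set F}) : zmod_closed (bperp A).
Proof.
split=> [|u v /bperpP hu /bperpP hv]; first by apply/bperpP => v _; apply: bil0l.
by apply/bperpP => w Aw; rewrite (oppx hF) bilDl hu ?hv ?addr0.
Qed.

(** The radical of the form below, since Tr(u^2 v) = Tr(u^4 v^2).  It is the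
    intersection of F with F_4. *)
Definition radical : {set F} := [set u | u ^+ 4 == u].

Lemma radical_bil u v : u \in radical -> bil u v = 0.
Proof.
rewrite inE => /eqP hu; rewrite /bil (TrD hF) -(Tr_sqr hF (_ * v)) exprMn -exprM hu.
exact: (addxx hF).
Qed.

Lemma radical_closed : zmod_closed radical.
Proof.
split=> [|u v]; rewrite !inE ?expr0n // => /eqP hu /eqP hv.
by rewrite (oppx hF) -{2}hu -{2}hv; apply/eqP; apply: (rmorphD (frob 2)).
Qed.

Lemma Tr_1 : Tr (1 : F) = (odd m)%:R.
Proof.
rewrite (TrE hF) (eq_bigr (fun=> 1)) => [|i _]; last by rewrite /frobenius expr1n.
rewrite sumr_const card_ord -[in LHS](odd_double_half m) mulrnDr.
by rewrite -muln2 mulrnA -mulr_natr [_ *+ 2]mulr2n (addxx hF) addr0.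
Qed.

(** The map t -> t^2 + t is two to one into the kernel of the trace, which is half of F. *)
Lemma artin_schreier c : Tr c = 0 -> exists t : F, t ^+ 2 + t = c.
Proof.
move=> hc; pose f (t : F) := t ^+ 2 + t.
have fib : (#|[set: F]| <= #|f @: [set: F]| * 2)%N.
  apply: (card_le_fibers (f := f)) => [t _|y /imsetP [t _ ->]]; first by rewrite imset_f ?inE.
  have c2 : (#|[set t; (t + 1)%R]| <= 2)%N by rewrite cards2; case: eqP.
  apply: leq_trans c2; apply: subset_leq_card; apply/subsetP => s; rewrite !inE /= => /eqP e.
  have : (s + t) * (s + t + 1) = 0.
    have -> : (s + t) * (s + t + 1) = f s + f t + 2 * (s * t) by rewrite /f; ring.
    by rewrite e (addxx hF) (two0 hF) mul0r addr0.
  move/eqP; rewrite mulf_eq0 -addrA !(addr_eq0_2 hF) => /orP [->|->] //.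
  by rewrite orbT.
have half := card_half hF (zmod_closed_setT F) (TrD hF) (Tr_0_or_1 hF).
have [x1 hx1] := Tr_onto hF.
have {}half := half (ex_intro2 _ _ x1 (in_setT x1) hx1).
have sub : f @: [set: F] \subset [set x in [set: F] | Tr x == 0].
  by apply/subsetP => _ /imsetP [t _ ->]; rewrite !inE /f (Tr_artin_schreier hF) ?eqxx //.
have eqf : f @: [set: F] = [set x in [set: F] | Tr x == 0].
  apply/eqP; rewrite eqEcard sub /= -(leq_pmul2r (isT : (0 < 2)%N)) half; exact: fib.
have : c \in f @: [set: F] by rewrite eqf !inE hc eqxx.
by case/imsetP => t _ ->; exists t.
Qed.

Lemma radical_odd : odd m -> radical = [set 0; 1].
Proof.
move=> om; apply/setP => u; rewrite !inE; apply/eqP/orP => [hu|[/eqP ->|/eqP ->]]; last 2 first.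
- by rewrite expr0n.
- by rewrite expr1n.
have f2 k : frob (k.*2) u = u.
  elim: k => [|k IH]; first by rewrite frob0.
  by rewrite doubleS -addn2 -frob_frob -[frob 2 u]/(u ^+ 4) hu IH.
have : u ^+ 2 = u.
  have := frob_m hF u; rewrite -[in X in frobenius _ X](odd_double_half m) om.
  by rewrite -frob_frob f2.
move/eqP; rewrite -subr_eq0 -{2}[u]mulr1 expr2 -mulrBr mulf_eq0 subr_eq0.
by case/orP => ->; [left|right].
Qed.

Lemma card_radical_odd : odd m -> #|radical| = 2%N.
Proof. by move/radical_odd => ->; rewrite cards2 eq_sym oner_eq0. Qed.

Lemma card_radical_even : ~~ odd m -> #|radical| = 4%N.
Proof.
move=> em; have [w hw] : exists t : F, t ^+ 2 + t = 1.
  by apply: artin_schreier; rewrite Tr_1 (negbTE em).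
have s01 : zmod_closed [set (0 : F); 1].
  split=> [|u v]; rewrite !inE ?eqxx // (oppx hF) => /orP [] /eqP -> /orP [] /eqP ->;
    by rewrite ?addr0 ?add0r ?(addxx hF) ?eqxx ?orbT.
have nw : w \notin [set 0; 1].
  rewrite !inE; apply/negP => /orP [] /eqP w0; move: hw; rewrite w0.
    by rewrite expr0n addr0 => /esym/eqP; rewrite oner_eq0.
  by rewrite expr1n (addxx hF) => /esym/eqP; rewrite oner_eq0.
have w2 : w ^+ 2 = w + 1.
  by apply/eqP; rewrite -(addr_eq0_2 hF) addrA hw (addxx hF).
have -> : radical = adjoin [set 0; 1] w.
  apply/setP => u; rewrite !inE; apply/eqP/idP => [hu|].
    have : u * (u + 1) * (u + w) * (u + w + 1) = 0.
      have -> : u * (u + 1) * (u + w) * (u + w + 1) = (u ^+ 4 + u)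
          + (w ^+ 2 + w + 1) * (u ^+ 2 + u) + 2 * (u ^+ 3 - u + u * w * (u ^+ 2 + u)) by ring.
      by rewrite hu hw !(addxx hF) (two0 hF) !mul0r !addr0.
    move/eqP; rewrite !mulf_eq0 -[u + w + 1]addrA !(addr_eq0_2 hF) -!orbA => /or4P [->|->|/eqP ->|/eqP ->] //.
    - by rewrite orbT.
    - by rewrite (addxx hF) eqxx !orbT.
    - by rewrite addrAC (addxx hF) add0r eqxx !orbT.
  have w4 : w ^+ 4 = w by rewrite (exprM w 2 2) w2 (sqrD2 hF) expr1n w2 -addrA (addxx hF) addr0.
  have f4 (x y : F) : (x + y) ^+ 4 = x ^+ 4 + y ^+ 4 := rmorphD (frob 2) x y.
  rewrite -orbA => /or4P [/eqP ->|/eqP ->||].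
  - by rewrite expr0n.
  - by rewrite expr1n.
  - by rewrite (addr_eq0_2 hF) => /eqP ->.
  - rewrite -(addr_eq0_2 hF) -addrA (addr_eq0_2 hF) => /eqP ->.
    by rewrite f4 w4 expr1n.
by rewrite card_adjoin // cards2 eq_sym oner_eq0.
Qed.


(** While 2^(r+i) < 2^(m-i) the orthogonal space is larger than A and A can be
    extended.  The orthogonal space is at most halved in each step, because A
    always contains the radical.  Along the way a functional agreeing with
    Tr(x^3) is extended too. *)
Lemma isotropic_chain (r : nat) : #|radical| = (2 ^ r)%N -> (exists a, forall u, u \in radical -> Tr (u ^+ 3) = Tr (a * u)) ->
  forall i, (r + i.*2 <= m)%N -> exists A a, [/\ zmod_closed A, #|A| = (2 ^ (r + i))%N,
    A \subset bperp A, (2 ^ m <= #|bperp A| * 2 ^ i)%N & forall u, u \in A -> Tr (u ^+ 3) = Tr (a * u)].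
Proof.
move=> cR [a ha]; elim=> [_|i IH ri].
  exists radical, a; split=> //; first exact: radical_closed.
  - by rewrite cR addn0.
  - by apply/subsetP => u hu; apply/bperpP => v _; apply: radical_bil.
  rewrite muln1 -hF -cardsT; apply: subset_leq_card; apply/subsetP => u _.
  by apply/bperpP => v hv; rewrite bilC radical_bil.
have [|A [c [hA cA iso le cub]]] := IH; first lia.
have [x xB nx] : exists2 x, x \in bperp A & x \notin A.
  apply/subsetPn; apply/negP => /subset_leq_card; rewrite cA => le2.
  have : (2 ^ m <= 2 ^ (r + i + i))%N.
    by apply: leq_trans le _; rewrite expnD leq_mul2r le2 orbT.
  by rewrite leq_exp2l //; lia.
have xP := bperpP _ _ xB.
have [c' hc'] : exists c', Tr (x ^+ 3) = Tr (c' * x) /\ forall u, u \in A -> Tr (u ^+ 3) = Tr (c' * u).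
  have [e|ne] := eqVneq (Tr (x ^+ 3)) (Tr (c * x)); first by exists c.
  have [t /perpP tA tx] := separate hA nx; exists (c + t).
  split=> [|u Au]; last by rewrite mulrDl (TrD hF) tA // addr0 cub.
  rewrite mulrDl (TrD hF) tx; move: ne.
  by case: (Tr_0_or_1 hF (x ^+ 3)) => ->; case: (Tr_0_or_1 hF (c * x)) => ->; rewrite ?eqxx // ?(addxx hF) ?add0r.
case: hc' => hx hc'; exists (adjoin A x), c'; split.
- exact: adjoin_closed.
- by rewrite card_adjoin // cA addnS expnSr.
- apply/subsetP => u hu; apply/bperpP => v hv.
  have isoA y z : y \in A -> z \in A -> bil y z = 0.
    by move=> Ay; apply: (bperpP _ _ (subsetP iso y Ay)).
  case/adjoinP: hu => y Ay; case/adjoinP: hv => z Az.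
  case=> ->; case=> ->.
  + exact: isoA.
  + by rewrite bilDl xP // isoA // addr0.
  + by rewrite bilC bilDl xP // isoA // addr0.
  + rewrite bilDl [bil x _]bilC [bil y _]bilC !bilDl bil_diag (bilC z x).
    by rewrite !xP // isoA // !addr0.
- have sub : bperp (adjoin A x) = [set u in bperp A | bil u x == 0].
    apply/setP => u; rewrite in_set; apply/bperpP/andP => [h|[/bperpP h /eqP hx0] v].
      split; first by apply/bperpP => v Av; apply: h; apply: sub_adjoin.
      by apply/eqP/h/mem_adjoin.
    case/adjoinP => w Aw [] ->; first exact: h.
    by rewrite bilC bilDl bilC hx0 add0r bilC h.
  have : (#|bperp A| <= #|bperp (adjoin A x)| * 2)%N.
    rewrite sub; have [/existsP [y /andP [yB /eqP hy]]|h] := boolP [exists y, (y \in bperp A) && (bil y x == 1)].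
      have := @card_half F m hF (bperp A) (fun u => bil u x) (bperp_closed A).
      rewrite leq_eqVlt => ->; rewrite ?eqxx //; last by exists y.
        by move=> u v; apply: bilDl.
      by move=> u; apply: (Tr_0_or_1 hF).
    rewrite (_ : [set u in bperp A | bil u x == 0] = bperp A); first by lia.
    apply/setP => u; rewrite in_set; case uB: (u \in bperp A) => //=.
    move: h; rewrite negb_exists => /forallP /(_ u); rewrite uB /=.
    by case: (Tr_0_or_1 hF (u ^+ 2 * x + u * x ^+ 2)) => e; rewrite /bil e eqxx.
  move=> le2; apply: leq_trans le _; rewrite expnS mulnA.
  by rewrite leq_mul2r le2 orbT.
move=> u /adjoinP [v Av]; case=> ->; first exact: hc'.
by rewrite Tr_cubeD hx (hc' _ Av) xP // addr0 mulrDr (TrD hF).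
Qed.

Theorem cubic_isotropic : (1 < m)%N -> exists A a, [/\ zmod_closed A, #|A| = (2 ^ (m %/ 2 + 1))%N
  & forall u, u \in A -> Tr (u ^+ 3) = Tr (a * u)].
Proof.
move=> m1; rewrite divn2; have := odd_double_half m; case om: (odd m) => mE.
  have [||A [a [h1 h2 _ _ h3]]] := isotropic_chain (r := 1) (card_radical_odd om) _ (i := m./2).
  - exists 1 => u; rewrite radical_odd // !inE => /orP [] /eqP ->.
      by rewrite mulr0 expr0n.
    by rewrite mulr1 expr1n.
  - lia.
  by exists A, a; split=> //; rewrite h2 addnC.
have [||A [a [h1 h2 _ _ h3]]] := isotropic_chain (r := 2) (card_radical_even (negbT om)) _ (i := m./2.-1).
- exists 0 => u; rewrite inE => /eqP hu; rewrite mul0r (Tr0 hF).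
  have [->|nu] := eqVneq u 0; first by rewrite expr0n (Tr0 hF).
  have -> : u ^+ 3 = 1 by apply: (mulIf nu); rewrite mul1r -exprSr.
  by rewrite Tr_1 om.
- lia.
exists A, a; split=> //; rewrite h2; congr (2 ^ _)%N; lia.
Qed.

End Existence.

(** * The theorem *)

Section Example.
Variables (F : finFieldType) (m : nat).
Hypothesis hF : #|F| = (2 ^ m)%N.

Lemma mathon_poly1 d : (0 < d)%N -> mathon_poly d (1 : {poly F}).
Proof.
case: d => // d _; exists (fun i : 'I_d.+1 => (i == 0 :> nat)%:R).
rewrite big_ord_recl big1 ?addr0 /= => [|i _]; last by rewrite scale0r.
by rewrite scale1r expr0.
Qed.

Lemma mathon_poly_cubic d (a0 a1 : F) : (2 < d)%N ->
  mathon_poly d (a0%:P + a1 *: 'X + 'X^3).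
Proof.
case: d => [|[|[|d]]] // _; exists (fun i : 'I_d.+3 => [:: a0; a1; 1]`_i).
rewrite !big_ord_recl big1 ?addr0 /= => [|i _]; last first.
  by rewrite nth_default ?scale0r.
by rewrite -[1%N]/(2 ^ 0)%N expr0 expr1 alg_polyC scale1r addrA.
Qed.

(** If the arc were Denniston, the cubic p would be affine on at least seven elements. *)
Theorem cubic_map_arc : (5 <= m)%N -> nonDenniston_p1_degree F (m %/ 2 + 1).
Proof.
move=> m5; have [|A [a [hA cA cub]]] := cubic_isotropic hF; first lia.
have [a0 ha0] := Tr_onto hF.
set d := (m %/ 2 + 1)%N in cA *.
have d3 : (2 < d)%N by rewrite /d; lia.
have dm : (d.+2 <= m)%N by rewrite /d; lia.
pose p : {poly F} := a0%:P + a *: 'X + 'X^3.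
have pE x : p.[x] = a0 + a * x + x ^+ 3 by rewrite /p !hornerE.
have hp : mathon_poly d p by apply: mathon_poly_cubic.
have hTr la : la \in A -> la != 0 -> Tr p.[la] = 1.
  move=> Ala _; rewrite pE !(TrD hF) cub // ha0 -addrA (addxx hF) addr0 //.
have hL := mathon_poly_additive hF hp.
exists (pq_arc p 1 A); split.
- exact: (pq_arc_maximal hF hA cA hTr hL).
- exists p, A; split=> //; split=> //; first by apply: mathon_poly1; lia.
  by move=> la Ala nla; rewrite hornerC mulr1 hTr.
move=> /(denniston_pencil hF hA cA hTr hL dm) [r [s rs]].
have cA0 : (4 < #|A :\ 0%R|)%N.
  have : #|A| = #|A :\ 0%R|.+1 by rewrite [LHS](cardsD1 0%R) (zmod_closed_0 hA).
  rewrite cA; have : (2 ^ 3 <= 2 ^ d)%N by rewrite leq_exp2l.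
  by move: #|_| (2 ^ d)%N => n1 n2; lia.
have /card_gt1P [x [y [Ax Ay nxy]]] : (1 < #|A :\ 0%R|)%N by apply: leq_trans cA0.
have [x0 {}Ax] := setD1P Ax; have [y0 {}Ay] := setD1P Ay.
have [|_ _ _ r0 _] := @quartic_eq0 F ((a0 + p.[x]) * r + x * s) (a * r + s) 0 r 0 (A :\ 0) _ cA0.
  move=> z /setD1P [z0 Az]; have [e _] := rs z x Az z0 Ax x0.
  rewrite -[RHS](addxx hF ((z + x) * s)) -{1}e (pE z); ring.
by case/eqP: nxy; have [_ ->] := rs x y Ax x0 Ay y0.
Qed.

End Example.

Local Close Scope ring_scope.

Theorem theorem2p6 (m : nat) (F : finFieldType)
    (hm : (5 <= m)%N) (hm9 : m <> 9%N) (hF : #|F| = (2 ^ m)%N) :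
  nonDenniston_p1_degree F (m %/ 2 + 1) /\
  (forall d : nat, nonDenniston_p1_degree F d -> (d <= m %/ 2 + 1)%N).
Proof.
split; first exact: (cubic_map_arc hF hm).
move=> d [K [_ [p [A [hmap KE]]] nden]]; rewrite leqNgt; apply/negP => hd.
apply: nden; rewrite KE.
by apply: (large_p1_map_denniston hF _ _ _ hmap); lia.
Qed.
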